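(* Let $L$ be a finite-dimensional Lie algebra over a field $K$ of characteristic zero such that $H^2(L,V)=0$ for every finite-dimensional $L$-module $V$. Then $L$ is one of the following: (1) a one-dimensional Lie algebra; (2) a semisimple Lie algebra; (3) the direct sum (as Lie algebras) of a semisimple Lie algebra and a one-dimensional Lie algebra.
   Context: $H^n(L,V)$ denotes the $n$-th Chevalley--Eilenberg cohomology of the Lie algebra $L$ with coefficients in the $L$-module $V$. A finite-dimensional Lie algebra is semisimple if its solvable radical is zero (in particular the zero Lie algebra counts as semisimple). *)

(* Defs.v *)
From HB Require Import structures.
From mathcomp Require Import all_boot all_order all_algebra.

Set Implicit Arguments.
Unset Strict Implicit.
Unset Printing Implicit Defensive.

Import GRing.Theory.
Local Open Scope ring_scope.

(* Finite dimension is part of vectType. *)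
HB.mixin Record Vector_isLieAlgebra (K : fieldType) L of Vector K L := {
  lie_bracket : L -> L -> L;
  lie_bracket_linearl : forall y, linear (lie_bracket^~ y);
  lie_bracket_linearr : forall x, linear (lie_bracket x);
  lie_bracketxx : forall x, lie_bracket x x = 0;
  lie_jacobi : forall x y z,
    lie_bracket x (lie_bracket y z) + lie_bracket y (lie_bracket z x)
      + lie_bracket z (lie_bracket x y) = 0
}.

#[short(type="lieAlgType")]
HB.structure Definition LieAlgebra (K : fieldType) :=
  {L of Vector K L & Vector_isLieAlgebra K L}.

Notation "[lie x , y ]" := (lie_bracket x y)
  (at level 0, x, y at level 99, format "[lie  x ,  y ]") : ring_scope.

Section DirectSum.

Variables (K : fieldType) (L M : lieAlgType K).

Let bracket (u v : (L * M)%type) : (L * M)%type :=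
  ([lie u.1, v.1], [lie u.2, v.2]).

Fact dsum_bracket_linearl v : linear (bracket^~ v).
Proof. by move=> a u w; congr pair; exact: lie_bracket_linearl. Qed.

Fact dsum_bracket_linearr u : linear (bracket u).
Proof. by move=> a v w; congr pair; exact: lie_bracket_linearr. Qed.

Fact dsum_bracketxx u : bracket u u = 0.
Proof. by congr pair; exact: lie_bracketxx. Qed.

Fact dsum_jacobi u v w :
  bracket u (bracket v w) + bracket v (bracket w u) + bracket w (bracket u v)
    = 0.
Proof. by congr pair; exact: lie_jacobi. Qed.

HB.instance Definition _ := Vector_isLieAlgebra.Build K (L * M)%type
  dsum_bracket_linearl dsum_bracket_linearr dsum_bracketxx dsum_jacobi.

End DirectSum.

Definition lie_isomorphic (K : fieldType) (L M : lieAlgType K) : Prop :=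
  exists f : {linear L -> M},
    bijective f /\ forall x y, f [lie x, y] = [lie f x, f y].

Section Semisimple.

Variables (K : fieldType) (L : lieAlgType K).
Implicit Types U V I R : {vspace L}.

(* As for prodv in falgebra.v, bases suffice because the bracket is bilinear. *)
Definition lie_bracketv U V : {vspace L} :=
  <<[seq [lie x, y] | x <- vbasis U, y <- vbasis V]>>%VS.

Definition lie_ideal I : Prop := (lie_bracketv fullv I <= I)%VS.

Definition lie_derived n U : {vspace L} :=
  iter n (fun W => lie_bracketv W W) U.

Definition lie_solvable U : Prop := exists n, lie_derived n U = 0%VS.

Definition is_lie_radical R : Prop :=
  [/\ lie_ideal R, lie_solvable R &
      forall I, lie_ideal I -> lie_solvable I -> (I <= R)%VS].

Definition lie_semisimple : Prop := is_lie_radical 0%VS.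

End Semisimple.

Arguments lie_semisimple {K} L.

Record is_lie_module (K : fieldType) (L : lieAlgType K) (V : vectType K)
    (act : L -> V -> V) : Prop := IsLieModule {
  lie_act_linearl : forall v, linear (act^~ v);
  lie_act_linearr : forall x, linear (act x);
  lie_act_bracket : forall x y v,
    act [lie x, y] v = act x (act y v) - act y (act x v)
}.

Section ChevalleyEilenberg.

Variables (K : fieldType) (L : lieAlgType K) (V : vectType K).
Variable act : L -> V -> V.

Definition ffun_upd n (x : {ffun 'I_n -> L}) (i : 'I_n) (u : L) :
    {ffun 'I_n -> L} :=
  [ffun k => if k == i then u else x k].

Definition is_multilinear n (f : {ffun 'I_n -> L} -> V) : Prop :=
  forall (x : {ffun 'I_n -> L}) i, linear (fun u => f (ffun_upd x i u)).

Definition is_alternating n (f : {ffun 'I_n -> L} -> V) : Prop :=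
  forall (x : {ffun 'I_n -> L}) i j, i != j -> x i = x j -> f x = 0.

Definition is_cochain n (f : {ffun 'I_n -> L} -> V) : Prop :=
  is_multilinear f /\ is_alternating f.

Definition omit n (x : {ffun 'I_n.+1 -> L}) (i : 'I_n.+1) :
    {ffun 'I_n -> L} :=
  [ffun k => x (lift i k)].

(* ([x_i, x_j], x_0, ..., x_n) without x_i and x_j, for i < j: the map        *)
(* k |-> bump j (bump i k) enumerates the indices other than i and j in       *)
(* increasing order.                                                          *)
Definition contract n (x : {ffun 'I_n.+1 -> L}) (i j : 'I_n.+1) :
    {ffun 'I_n -> L} :=
  [ffun k : 'I_n => if k == 0%N :> nat then [lie x i, x j]
                    else x (inord (bump j (bump i k.-1)))].

Definition ce_diff n (f : {ffun 'I_n -> L} -> V) (x : {ffun 'I_n.+1 -> L}) :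
    V :=
  \sum_(i < n.+1) (-1) ^+ i *: act (x i) (f (omit x i))
  + \sum_(i < n.+1) \sum_(j < n.+1 | (i < j)%N)
      (-1) ^+ (i + j) *: f (contract x i j).

Definition is_cocycle n (f : {ffun 'I_n -> L} -> V) : Prop :=
  is_cochain f /\ forall x, ce_diff f x = 0.

Definition is_coboundary n : ({ffun 'I_n -> L} -> V) -> Prop :=
  match n with
  | 0 => fun f => forall x, f x = 0
  | m.+1 => fun f => exists2 g : {ffun 'I_m -> L} -> V,
              is_cochain g & forall x, f x = ce_diff g x
  end.

(* H^n(L, V) = Z^n(L, V) / B^n(L, V) = 0. *)
Definition ce_cohomology_zero n : Prop :=
  forall f : {ffun 'I_n -> L} -> V, is_cocycle f -> is_coboundary f.

End ChevalleyEilenberg.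

(* Main.v *)
Require Import Defs.
From HB Require Import structures.
From mathcomp Require Import all_boot all_order all_algebra all_field ring zify.
From Stdlib Require Import Classical.

(** Write R for the radical of L, S = L / R and A = R / [R, R].  Whitehead's second
    lemma for S, obtained from Cartan's criterion and Casimir operators, yields a
    1-cocycle phi : L -> A extending the projection R -> A.

    If H^2(L, -) = 0, then 1-cocycles lift along surjections of modules.  When
    dim A >= 2, lift phi to the module of A-valued multilinear functions of k
    affine functions on A: for a, b in R with independent images in A, the
    lift shows that the elements (ad a)^j [a, b] with j < k are independent,
    which is absurd for large k.

    When dim A = 1, S acts trivially on A, so that phi is a character of L; take x
    in R with phi x = 1.  If B = [R, R] is not zero, then x acts invertibly on
    B / [B, B], the projection of B extends to a cocycle psi on L, and the class of
    phi /\ psi is not zero: a primitive would give an operator whose commutator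
    with x is the identity.  So B = 0 and L is the product of S and K. *)

(** A cocycle on [L] extending [R -> A] amounts to a Levi splitting of [L / [R, R]]. The obstruction
    lies in H^2(S, A), and since the hypothesis speaks of modules over [L] and not of its
    restriction to [S], Whitehead's lemma is proved for [S] itself. As [K] need not be algebraically
    closed, Cartan's criterion takes eigenvalues in a splitting field, where a Q-linear form on
    their span replaces complex conjugation.

    Two independent directions in [A] matter because [b] is detected through [a]: a coordinate
    function can be sent by [a] to a nonzero constant and killed by [b]. Applying [a] k times to a
    multilinear function and evaluating at k copies of that coordinate gives k! times its value at
    constants, whereas any application of [b] contributes nothing; so the lifted cocycle sees
    [phi b] at the k-th step and zero beyond. With dim A = 1 no such [b] exists, whence the separate
    trace argument.

    A nonzero solvable [L] falls under the third alternative with [S] zero. *)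

Set Implicit Arguments.
Unset Strict Implicit.
Unset Printing Implicit Defensive.

Import Order.TTheory GRing.Theory Num.Theory VectorInternalTheory.
Local Open Scope ring_scope.

(** * Subspaces, rational forms and polynomials of operators *)

(** [P] need not be decidable: by excluded middle a subspace inside [P] is enlarged one vector at a
    time, which stops by dimension. *)
Lemma vspace_of_pred (K : fieldType) (V : vectType K) (P : V -> Prop) :
  P 0 -> (forall a u v, P u -> P v -> P (a *: u + v)) ->
  exists U : {vspace V}, forall v, v \in U <-> P v.
Proof.
move=> P0 PD.
suff H n (U : {vspace V}) : (forall v, v \in U -> P v) ->
    (dim V - \dim U <= n)%N -> exists U' : {vspace V}, forall v, v \in U' <-> P v.
  apply: (H _ 0%VS _ (leqnn _)) => v.
  by rewrite memv0 => /eqP ->.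
elim: n U => [|n IHn] U UP dU.
  exists U => v; split=> [|Pv]; first exact: UP.
  suff -> : U = fullv by rewrite memvf.
  apply/eqP; rewrite eqEdim subvf dimvf /=; lia.
have [[v [Pv vU]]|noV] := classic (exists v, P v /\ v \notin U); last first.
  exists U => v; split=> [|Pv]; first exact: UP.
  by apply/negPn/negP => vU; apply: noV; exists v.
apply: (IHn (U + <[v]>)%VS) => [w /memv_addP[u uU [_ /vlineP[k ->] ->]]|].
  by rewrite addrC; apply: PD => //; exact: UP.
have v0 : v != 0 by apply: contraNneq vU => ->; rewrite mem0v.
have -> : \dim (U + <[v]>) = (\dim U).+1.
  rewrite dimv_disjoint_sum ?dim_vline ?v0 ?addn1 //.
  apply/eqP; rewrite -subv0; apply/subvP => w.
  rewrite memv_cap => /andP[wU /vlineP[k wE]]; rewrite memv0 wE scaler_eq0.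
  apply: contraNT vU; rewrite negb_or => /andP[k0 _].
  by rewrite -[v](scalerK k0) -wE memvZ.
lia.
Qed.

Section Char0.

Variables (F : fieldType) (charF0 : [pchar F] =i pred0).

Lemma pchar0_natf_eq0 n : (n%:R == 0 :> F) = (n == 0)%N.
Proof. exact: (pcharf0P F).1. Qed.

Lemma pchar0_intr_eq0 (z : int) : (z%:~R == 0 :> F) = (z == 0).
Proof. by case: z => n; rewrite ?NegzE ?mulrNz ?oppr_eq0 pchar0_natf_eq0. Qed.

(** Nonzero integers stay nonzero in [F], so [ratr] may be computed on any fraction and not only the
    reduced one. Its additivity and multiplicativity over an unordered field both come from this. *)
Lemma pchar0_ratrP (a : int) (b : int) : b != 0 ->
  ratr (a%:~R / b%:~R) = a%:~R / b%:~R :> F.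
Proof.
move=> b0; set q := _ / _; rewrite /ratr.
have dq0 : denq q != 0 by rewrite denq_eq0.
have : numq q * b = a * denq q.
  apply: (@intr_inj rat); rewrite !intrM.
  have /eqP := divq_num_den q; rewrite {3}/q => /eqP E.
  have bq : b%:~R != 0 :> rat by rewrite intr_eq0.
  have dq : (denq q)%:~R != 0 :> rat by rewrite intr_eq0.
  by apply/eqP; rewrite -eqr_div // E.
move=> /(congr1 (fun z : int => z%:~R : F)); rewrite !intrM => E.
by apply/eqP; rewrite eqr_div ?pchar0_intr_eq0 // E.
Qed.

Lemma pchar0_ratrD p q : ratr (p + q) = ratr p + ratr q :> F.
Proof.
have dp : denq p != 0 by rewrite denq_eq0.
have dq : denq q != 0 by rewrite denq_eq0.
have -> : p + q = (numq p * denq q + numq q * denq p)%:~R / (denq p * denq q)%:~R.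
  rewrite -[p in LHS]divq_num_den -[q in LHS]divq_num_den addf_div ?intr_eq0 //.
  by rewrite intrD !intrM.
rewrite pchar0_ratrP ?mulf_neq0 // intrD !intrM -addf_div ?pchar0_intr_eq0 //.
Qed.

Lemma pchar0_ratrB p q : ratr (p - q) = ratr p - ratr q :> F.
Proof. by apply/(canRL (addrK _)); rewrite -pchar0_ratrD subrK. Qed.

Lemma pchar0_ratrM p q : ratr (p * q) = ratr p * ratr q :> F.
Proof.
have dp : denq p != 0 by rewrite denq_eq0.
have dq : denq q != 0 by rewrite denq_eq0.
have -> : p * q = (numq p * numq q)%:~R / (denq p * denq q)%:~R.
  by rewrite -[p in LHS]divq_num_den -[q in LHS]divq_num_den mulf_div !intrM.
by rewrite pchar0_ratrP ?mulf_neq0 // !intrM -mulf_div.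
Qed.

(* The rational relations between the [l i] are annihilated by some r <> 0, i.e.
   l i |-> r i extends to a Q-linear form on the Q-span of the [l i]. *)
Lemma rational_form k (l : 'I_k -> F) i0 : l i0 != 0 ->
  exists2 r : 'I_k -> rat, exists i, r i != 0 &
    forall q : 'I_k -> rat, \sum_i ratr (q i) * l i = 0 -> \sum_i q i * r i = 0.
Proof.
move=> li0.
have [||U UP] := @vspace_of_pred _ 'rV[rat]_k
    (fun q => \sum_i ratr (q 0 i) * l i = 0).
- by rewrite big1 // => i _; rewrite mxE /ratr /= mul0r mul0r.
- move=> a u v u0 v0; under eq_bigr do
    rewrite !mxE pchar0_ratrD pchar0_ratrM mulrDl -mulrA.
  by rewrite big_split -mulr_sumr /= u0 v0 mulr0 addr0.
have drk : dim ('rV[rat]_k : vectType rat) = k := mul1n k.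
pose M := \matrix_(i < \dim U) (vbasis U)`_i.
(* The space [U] of relations is proper, since [l i0 != 0] excludes the relation concentrated at
   [i0]; any nonzero vector orthogonal to [U] serves as [r]. *)
have rM : (\rank M < k)%N.
  apply: leq_ltn_trans (rank_leq_row _) _.
  have := dimvS (subvf U); rewrite dimvf drk leq_eqVlt => /orP[/eqP dU|//].
  case/negP: li0.
  have /UP : delta_mx 0 i0 \in U.
    suff -> : U = fullv by rewrite memvf.
    by apply/eqP; rewrite eqEdim subvf dimvf drk dU leqnn.
  rewrite (bigD1 i0) //= big1 ?addr0 => [|i /negPf ni]; last first.
    by rewrite mxE eqxx ni /ratr /= !mul0r.
  by rewrite mxE !eqxx /ratr /= divr1 mul1r => ->.
have /rowV0Pn [r /sub_kermxP rM0 r0] : kermx M^T != 0.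
  by rewrite kermx_eq0 /row_free mxrank_tr neq_ltn rM.
exists (r 0) => [|q q0].
  apply/existsP; apply: contraNT r0; rewrite negb_exists => /forallP r0.
  by apply/eqP/rowP => i; rewrite mxE; apply/eqP/negPn/r0.
have qU : \row_i q i \in U by apply/UP; under eq_bigr do rewrite mxE.
have -> : \sum_i q i * r 0 i = (r *m (\row_i q i)^T) 0 0.
  by rewrite mxE; apply: eq_bigr => i _; rewrite !mxE mulrC.
rewrite (coord_vbasis qU) linear_sum /= mulmx_sumr summxE big1 // => i _.
rewrite linearZ /= -scalemxAr mxE.
have := congr1 (fun N : 'rV_(\dim U) => N 0 i) rM0.
rewrite !mxE => rM0i; apply/eqP; rewrite mulf_eq0; apply/orP; right.
by rewrite -[X in _ == X]rM0i; apply/eqP; apply: eq_bigr => j _; rewrite !mxE.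
Qed.

End Char0.

Section PolyAction.

Variables (F : fieldType) (V : lmodType F) (T : {linear V -> V}).

Definition poly_act (p : {poly F}) v := \sum_(i < size p) p`_i *: iter i T v.

Lemma iter_is_linear k : linear (iter k T).
Proof. by elim: k => [|k IHk] a u v //=; rewrite IHk linearP. Qed.

Lemma poly_act_widen m (p : {poly F}) v : (size p <= m)%N ->
  poly_act p v = \sum_(i < m) p`_i *: iter i T v.
Proof.
move=> pm; rewrite /poly_act (big_ord_widen m (fun i => p`_i *: iter i T v)) //.
rewrite big_mkcond; apply: eq_bigr => i _; case: ltnP => // pi.
by rewrite nth_default // scale0r.
Qed.

Lemma poly_actD p q v : poly_act (p + q) v = poly_act p v + poly_act q v.
Proof.
pose m := maxn (size p) (size q).
rewrite !(@poly_act_widen m) ?leq_maxl ?leq_maxr ?size_polyD //.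
by rewrite -big_split; apply: eq_bigr => i _; rewrite coefD scalerDl.
Qed.

Lemma poly_actZ a p v : poly_act (a *: p) v = a *: poly_act p v.
Proof.
rewrite (@poly_act_widen (size p)) ?size_scale_leq //.
by rewrite scaler_sumr; apply: eq_bigr => i _; rewrite coefZ scalerA.
Qed.

Lemma poly_actMX p v : poly_act (p * 'X) v = poly_act p (T v).
Proof.
rewrite (@poly_act_widen (size p).+1); last first.
  have [->|p0] := eqVneq p 0; first by rewrite mul0r size_poly0.
  by rewrite size_mulX.
rewrite big_ord_recl coefMX scale0r add0r; apply: eq_bigr => i _.
by rewrite coefMX /= -iterSr.
Qed.

Lemma poly_act0 p : poly_act p 0 = 0.
Proof.
rewrite /poly_act big1 // => i _.
have : iter i T 0 = 0 by elim: (val i) => //= k ->; rewrite linear0.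
by move=> ->; rewrite scaler0.
Qed.

Lemma poly_act_polyC a v : poly_act a%:P v = a *: v.
Proof. by rewrite (@poly_act_widen 1) ?size_polyC_leq1 // big_ord1 coefC. Qed.

Lemma poly_act_XsubC p a v :
  poly_act (p * ('X - a%:P)) v = poly_act p (T v - a *: v).
Proof.
rewrite mulrBr poly_actD poly_actMX mulrC mul_polyC -scaleNr poly_actZ.
rewrite /poly_act scaler_sumr -big_split; apply: eq_bigr => i _ /=.
have -> : iter i T (T v - a *: v) = iter i T (- a *: v + T v).
  by rewrite addrC scaleNr.
by rewrite iter_is_linear scalerDr addrC !scalerA mulrC.
Qed.

(** On a vector killed by the [M]-th power of [T - a], a polynomial matters only modulo
    [('X - a%:P) ^+ M]. *)
Lemma poly_act_eigen M a b p v : ('X - a%:P) ^+ M %| p - b%:P ->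
  iter M (fun u => T u - a *: u) v = 0 -> poly_act p v = b *: v.
Proof.
move=> /dvdpP[q pE] v0; have -> : p = q * ('X - a%:P) ^+ M + b%:P.
  by rewrite -pE subrK.
rewrite poly_actD poly_act_polyC; suff -> : poly_act (q * ('X - a%:P) ^+ M) v = 0.
  by rewrite add0r.
elim: M q v v0 {pE} => [|M IHM] q v; first by move=> /= ->; rewrite poly_act0.
by rewrite iterSr => v0; rewrite exprSr mulrA poly_act_XsubC IHM.
Qed.

End PolyAction.

Lemma coprimep_prod_XsubCX (F : fieldType) (s : seq F) x N : x \notin s ->
  coprimep (\prod_(y <- s) ('X - y%:P) ^+ N) (('X - x%:P) ^+ N).
Proof.
move=> xs; apply: coprimep_expr; rewrite coprimep_XsubC.
rewrite /root horner_prod prodf_seq_eq0; apply/hasPn => y ys /=.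
rewrite horner_exp !hornerE expf_eq0 negb_and subr_eq0.
by apply/orP; right; apply: contraNneq xs => ->.
Qed.

(** Chinese remaindering: the Bezout term [u * W] is 1 modulo the new factor and 0 modulo the old
    ones, so it corrects [Q] at [x] alone. *)
Lemma crt_XsubC (F : fieldType) (s : seq F) (c : F -> F) N : uniq s ->
  exists Q : {poly F}, forall x, x \in s -> ('X - x%:P) ^+ N %| Q - (c x)%:P.
Proof.
elim: s => [|x s IHs] /=; first by exists 0.
case/andP=> xs /IHs[Q Qs]; pose W := \prod_(y <- s) ('X - y%:P) ^+ N.
have /Bezout_eq1_coprimepP[[u v] /= uv] := coprimep_prod_XsubCX N xs.
exists (Q + ((c x)%:P - Q) * (u * W)) => y; rewrite inE => /orP[/eqP->|ys].
  have -> : Q + ((c x)%:P - Q) * (u * W) - (c x)%:P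
      = (Q - (c x)%:P) * v * ('X - x%:P) ^+ N.
    have -> : u * W = 1 - v * ('X - x%:P) ^+ N by rewrite -uv addrK.
    by ring.
  exact: dvdp_mulIr.
rewrite addrAC dvdp_add ?Qs // !mulrA dvdp_mull // /W.
by rewrite (big_rem y) //= dvdp_mulIl.
Qed.

(** Left multiplication by [A] and right multiplication by [C] commute, so every term of the
    expanded power has at least [i] factors [A] or [j] factors [C]. The induction trades one unit of
    [i] or of [j] at each application. *)
Lemma iter_commutator (F : fieldType) n (A B C : 'M[F]_n) i j :
  A ^+ i *m B = 0 -> B *m C ^+ j = 0 ->
  iter (i + j) (fun X => A *m X - X *m C) B = 0.
Proof.
have T0 k : iter k (fun X => A *m X - X *m C) 0 = 0.
  by elim: k => //= k ->; rewrite mulmx0 mul0mx subr0.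
have TB k X Y : iter k (fun X => A *m X - X *m C) (X - Y) =
    iter k (fun X => A *m X - X *m C) X - iter k (fun X => A *m X - X *m C) Y.
  elim: k => //= k ->; rewrite mulmxBr mulmxBl.
  by rewrite !opprB addrACA [RHS]addrACA; congr (_ + _); rewrite addrC.
have [m] := ubnP (i + j); elim: m i j B => // m IHm [|i] [|j] B;
  rewrite ltnS => ijm Ai Cj.
- by move: Ai; rewrite expr0 mul1mx => ->.
- by move: Ai; rewrite expr0 mul1mx => ->.
- by move: Cj; rewrite expr0 mulmx1 => ->.
have ABC : (A *m B) *m C ^+ j.+1 = 0 by rewrite -mulmxA Cj mulmx0.
have AAB : A ^+ i *m (A *m B) = 0 by rewrite mulmxA -[A ^+ i *m A]/(A ^+ i * A)
  -exprSr.
have BCC : (B *m C) *m C ^+ j = 0 by rewrite -mulmxA -[C *m C ^+ j]/(C * C ^+ j)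
  -exprS.
have ABC' : A ^+ i.+1 *m (B *m C) = 0 by rewrite mulmxA Ai mul0mx.
rewrite addSn iterSr TB (IHm _ _ _ _ AAB ABC); last by lia.
by rewrite addnS -addSn (IHm _ _ _ _ ABC' BCC) ?subr0 //; lia.
Qed.

Lemma char_poly_lblock (F : fieldType) n1 n2 (A : 'M[F]_n1) (C : 'M_(n2, n1))
    (B : 'M_n2) :
  char_poly (block_mx A 0 C B) = char_poly A * char_poly B.
Proof.
rewrite /char_poly /char_poly_mx map_block_mx /= map_mx0 scalar_mx_block.
by rewrite opp_block_mx add_block_mx oppr0 addr0 det_lblock.
Qed.

Lemma char_poly_conj (F : fieldType) n (P A : 'M[F]_n) : P \in unitmx ->
  char_poly (P *m A *m invmx P) = char_poly A.
Proof.
move=> Pu; rewrite /char_poly /char_poly_mx.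
have PP : map_mx polyC P *m map_mx polyC (invmx P) = 1%:M.
  by rewrite -map_mxM mulmxV // map_mx1.
have -> : 'X%:M - map_mx polyC (P *m A *m invmx P) =
    map_mx polyC P *m ('X%:M - map_mx polyC A) *m map_mx polyC (invmx P).
  rewrite mulmxBr mulmxBl !map_mxM; congr (_ - _).
  by rewrite scalar_mxC -mulmxA PP mulmx1.
by rewrite !det_mulmx mulrAC -det_mulmx PP det1 mul1r.
Qed.

(** Deflation: an eigenvector completed to a basis makes [A] block triangular with corner [x], and
    the other diagonal block has the remaining roots. *)
Lemma mxtrace_expr (F : fieldType) n (A : 'M[F]_n) (ls : seq F) k :
  char_poly A = \prod_(x <- ls) ('X - x%:P) ->
  \tr (A ^+ k) = \sum_(x <- ls) x ^+ k.
Proof.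
elim: n A ls => [|n IHn] A ls Als.
  have := size_char_poly A; rewrite Als size_prod_XsubC => -[/size0nil->].
  by rewrite big_nil /mxtrace big_ord0.
case: ls Als => [|x ls] Als.
  by have := size_char_poly A; rewrite Als big_nil size_poly1.
have /eigenvalueP[v vA v0] : eigenvalue A x.
  by rewrite eigenvalue_root_char Als big_cons rootM root_XsubC eqxx.
pose P := row_ebase v; have Pu : P \in unitmx by exact: row_ebase_unit.
pose B : 'M[F]_(1 + n) := P *m A *m invmx P.
(* [row_ebase v] is invertible with first row proportional to [v], so it is the base change
   wanted. *)
have vP : exists2 c, c != 0 & v = c *: row 0 P.
  have rv : \rank v = 1%N by rewrite rank_rV v0.
  have vE := mulmx_ebase v; rewrite rv in vE.
  exists (col_ebase v 0 0).
    apply: contraNneq v0 => c0; rewrite -vE.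
    by rewrite [col_ebase v]mx11_scalar c0 -scalemx1 scale0r !mul0mx.
  rewrite -[LHS]vE [col_ebase v]mx11_scalar -mulmxA mul_scalar_mx; congr (_ *: _).
    by rewrite mxE.
  rewrite rowE; congr (_ *m _); apply/rowP => j; rewrite !mxE /= andbT eq_sym.
  by [].
have [c c0 vE] := vP.
have Bu : row 0 B = x *: delta_mx 0 0.
  rewrite !row_mul.
  have -> : row 0 P *m A = x *: row 0 P.
    by apply: (scalerI c0); rewrite scalemxAl -vE vA vE !scalerA mulrC.
  by rewrite -scalemxAl rowE -mulmxA mulmxV // mulmx1.
have BuE j : B 0 j = x *+ (j == 0).
  by have := congr1 (fun M : 'rV_(1 + n) => M 0 j) Bu; rewrite !mxE mulr_natr.
have l0 (i : 'I_1) : lshift n i = 0 by apply: val_inj; rewrite ord1.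
have BE : B = block_mx x%:M 0 (dlsubmx B) (drsubmx B).
  move: (B) BuE => C CE; rewrite -[LHS]submxK.
  by congr block_mx; apply/matrixP => i j; rewrite ?ord1 !mxE ?l0 CE.
have trB : \tr (A ^+ k) = \tr (B ^+ k).
  suff -> : B ^+ k = P *m A ^+ k *m invmx P.
    by rewrite mxtrace_mulC mulmxA mulVmx // mul1mx.
  elim: (k) => [|m IHm]; first by rewrite !expr0 mulmx1 mulmxV.
  by rewrite !exprS IHm -!mulmxE !mulmxA mulmxKV.
have BX m : exists C, B ^+ m = block_mx (x ^+ m)%:M 0 C (drsubmx B ^+ m).
  elim: m => [|m [C IHm]]; first by exists 0; rewrite !expr0 -scalar_mx_block.
  rewrite !exprS IHm {1}BE -!mulmxE mulmx_block !mul0mx !mulmx0 !addr0 add0r.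
  by eexists; rewrite -scalar_mxM.
rewrite trB; have [C ->] := BX k.
rewrite mxtrace_block mxtrace_scalar mulr1n big_cons; congr (_ + _).
apply: IHn; apply: (@mulfI _ ('X - x%:P)); first by rewrite polyXsubC_eq0.
have := Als; rewrite big_cons => <-; rewrite -(char_poly_conj A Pu).
rewrite [RHS](congr1 char_poly BE : char_poly B = _) char_poly_lblock.
congr (_ * _); rewrite /char_poly det_mx11 !mxE; first by [].
Qed.

(** * Cartan's criterion for matrices *)

Lemma horner_mx_XsubCX (F : fieldType) n (A : 'M[F]_n.+1) x N :
  horner_mx A (('X - x%:P) ^+ N) = (A - x%:M) ^+ N.
Proof. by rewrite rmorphXn rmorphB /= horner_mx_X horner_mx_C. Qed.

(** The generalized eigenspace decomposition as an induction principle: Bezout splits [B] into a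
    part killed by the power for [x] and a part killed by the other factors. *)
Lemma geigen_ind (F : fieldType) n (A : 'M[F]_n.+1) s N (Phi : 'M[F]_n.+1 -> Prop) :
  uniq s -> Phi 0 -> (forall B C, Phi B -> Phi C -> Phi (B + C)) ->
  (forall x B, x \in s -> (A - x%:M) ^+ N *m B = 0 -> Phi B) ->
  forall B, horner_mx A (\prod_(x <- s) ('X - x%:P) ^+ N) *m B = 0 -> Phi B.
Proof.
move=> + Phi0 PhiD; elim: s => [_ _ B|x s IHs /= /andP[xs us] Phis B].
  by rewrite big_nil rmorph1 mul1mx => ->.
rewrite big_cons; set W := \prod_(y <- s) _ => WB.
have /Bezout_eq1_coprimepP[[u v] /= uv] := coprimep_prod_XsubCX N xs.
have -> : B = horner_mx A (W * u) *m B + horner_mx A (('X - x%:P) ^+ N * v) *m B.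
  by rewrite -mulmxDl -rmorphD /= mulrC [_ * v]mulrC uv rmorph1 mul1mx.
have kill p q r : p * q = r * (('X - x%:P) ^+ N * W) ->
    horner_mx A p *m (horner_mx A q *m B) = 0.
  by move=> pq; rewrite mulmxA mulmxE -rmorphM pq rmorphM /= -!mulmxE -mulmxA WB
    mulmx0.
apply: PhiD.
  apply: (Phis x); first by rewrite inE eqxx.
  by rewrite -horner_mx_XsubCX; apply: (@kill _ _ u); rewrite mulrA mulrC.
apply: IHs => // [y C ys|]; first by apply: Phis; rewrite inE ys orbT.
by apply: (@kill _ _ v); rewrite mulrCA mulrA mulrC.
Qed.

Lemma char_poly_trmx (F : fieldType) n (A : 'M[F]_n) : char_poly A^T = char_poly A.
Proof.
rewrite /char_poly -det_tr; congr (\det _).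
by rewrite /char_poly_mx linearB /= tr_scalar_mx map_trmx trmxK.
Qed.

Lemma mxtrace_horner (F : fieldType) n (A : 'M[F]_n.+1) (ls : seq F) p :
  char_poly A = \prod_(x <- ls) ('X - x%:P) ->
  \tr (horner_mx A p) = \sum_(x <- ls) p.[x].
Proof.
move=> Als; rewrite -[p in LHS]coefK poly_def rmorph_sum /= raddf_sum /=.
under eq_bigr do rewrite linearZ /= rmorphXn /= horner_mx_X mxtraceZ (mxtrace_expr _
  Als) mulr_sumr.
by rewrite exchange_big; apply: eq_bigr => x _; rewrite horner_coef.
Qed.

(* Modulo high powers, Q is the constant g x at x and P is the constant
   gd (x - y) at x - y, so both sides scale every B that is killed by powers of
   A - x on the left and of A - y on the right by the same factor. *)
Lemma commutator_poly (F : fieldType) n (A : 'M[F]_n.+1) (ls : seq F)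
    (g gd : F -> F) :
  char_poly A = \prod_(x <- ls) ('X - x%:P) ->
  {in ls &, forall x y, gd (x - y) = g x - g y} ->
  exists P Q : {poly F}, {in ls, forall x, Q.[x] = g x} /\
    forall B : 'M_n.+1, poly_act (mulmx A \- mulmxr A) P B =
      horner_mx A Q *m B - B *m horner_mx A Q.
Proof.
move=> Als gdE; pose N := n.+1.
have [Q QP] := crt_XsubC g N (undup_uniq ls).
(* The exponent doubles because [iter_commutator] adds the exponent on the left of [B] to the one on
   its right. *)
have [P PP] := crt_XsubC gd (N + N) (undup_uniq [seq x - y | x <- ls, y <- ls]).
exists P, Q; split=> [x xls|].
  have /QP : x \in undup ls by rewrite mem_undup.
  move/(dvdp_trans (dvdp_exp2l _ (isT : (1 <= N)%N))); rewrite expr1.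
  by rewrite dvdp_XsubCl /root !hornerE subr_eq0 => /eqP.
pose T : {linear 'M[F]_n.+1 -> 'M[F]_n.+1} := mulmx A \- mulmxr A.
pose W := \prod_(x <- undup ls) ('X - x%:P) ^+ N.
have W0 C : char_poly C = char_poly A -> horner_mx C W = 0.
  move=> CA; suff /dvdpP[q ->] : char_poly C %| W.
    by rewrite rmorphM /= Cayley_Hamilton mulr0.
  have sz : size ls = N.
    by have := size_char_poly A; rewrite Als size_prod_XsubC => -[].
  rewrite CA Als -(prodr_undup_exp_count ls predT) /W.
  elim: (undup ls) => [|x s IHs]; first by rewrite !big_nil.
  rewrite !big_cons /=; apply: dvdp_mul => //; apply: dvdp_exp2l.
  by rewrite -sz count_size.
pose Phi B := poly_act T P B = horner_mx A Q *m B - B *m horner_mx A Q.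
have Phi0 : Phi 0 by rewrite /Phi poly_act0 mul0mx mulmx0 subrr.
have PhiD B C : Phi B -> Phi C -> Phi (B + C).
  rewrite /Phi => PB PC; rewrite -[C](scale1r C) addrC.
  have -> : poly_act T P (1 *: C + B) = poly_act T P C + poly_act T P B.
    rewrite /poly_act -big_split; apply: eq_bigr => i _.
    by rewrite iter_is_linear scale1r scalerDr.
  rewrite PB PC scale1r mulmxDl mulmxDr opprD addrACA //.
have geig x B : x \in undup ls -> (A - x%:M) ^+ N *m B = 0 ->
    horner_mx A Q *m B = g x *: B.
  move=> /QP /dvdpP[q qE] AB.
  have -> : Q = q * ('X - x%:P) ^+ N + (g x)%:P by rewrite -qE subrK.
  rewrite rmorphD rmorphM /= horner_mx_XsubCX horner_mx_C mulmxDl -mulmxE.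
  by rewrite -mulmxA AB mulmx0 add0r mul_scalar_mx.
have geig' x B : x \in undup ls -> B *m (A - x%:M) ^+ N = 0 ->
    B *m horner_mx A Q = g x *: B.
  move=> /QP /dvdpP[q qE] AB.
  have -> : Q = ('X - x%:P) ^+ N * q + (g x)%:P by rewrite mulrC -qE subrK.
  rewrite rmorphD rmorphM /= horner_mx_XsubCX horner_mx_C mulmxDr -mulmxE.
  by rewrite mulmxA AB mul0mx add0r mul_mx_scalar.
move=> B; change (Phi B).
apply: (@geigen_ind _ _ A (undup ls) N Phi) => //; rewrite ?undup_uniq //; last first.
  by rewrite W0 // mul0mx.
move=> x {}B xls AB; rewrite -[B]mulmx1 -[1%:M]trmxK.
(* Right generalized eigenspaces of [A] are left ones of its transpose, so the same principle
   decomposes the identity standing to the right of [B]. *)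
apply: (@geigen_ind _ _ A^T (undup ls) N (fun C => Phi (B *m C^T))).
- exact: undup_uniq.
- by rewrite trmx0 mulmx0.
- by move=> C D PC PD; rewrite linearD mulmxDr; apply: PhiD.
- move=> y C yls AC.
  have CA : C^T *m (A - y%:M) ^+ N = 0.
    apply: trmx_inj; rewrite trmx_mul trmxK trmx0 -[RHS]AC; congr (_ *m _).
    elim: N {QP PP W W0 geig geig' AB AC} => [|k IHk]; first by rewrite !expr0 trmx1.
    by rewrite exprSr exprS -!mulmxE trmx_mul IHk linearB /= tr_scalar_mx.
  have ABC : (A - x%:M) ^+ N *m (B *m C^T) = 0 by rewrite mulmxA AB mul0mx.
  have BCA : (B *m C^T) *m (A - y%:M) ^+ N = 0 by rewrite -mulmxA CA mulmx0.
  rewrite /Phi (geig _ _ _ xls ABC) (geig' _ _ _ yls BCA) -scalerBl.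
  move: xls yls; rewrite !mem_undup => xls yls; rewrite -(gdE x y xls yls).
  have xyls : x - y \in undup [seq x - y | x <- ls, y <- ls].
    by rewrite mem_undup; apply: allpairs_f.
  apply: (poly_act_eigen (PP _ xyls)).
  rewrite -(iter_commutator ABC BCA); apply: eq_iter => X /=.
  rewrite mulmxBl mulmxBr mul_scalar_mx mul_mx_scalar scalerBl.
  by apply/matrixP => i j; rewrite !mxE; ring.
- by rewrite W0 ?char_poly_trmx // mul0mx.
Qed.

(** Applying the Q-linear form [r] to [\sum r i * l i = 0], which says that [A] is orthogonal to a
    polynomial in [A] with eigenvalues [r i], gives [\sum r i ^ 2 = 0] in Q. The coefficients [c]
    and [d] are explicit so that the data can be carried to an extension field. *)
Lemma cartan_split (F : fieldType) (charF0 : [pchar F] =i pred0) n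
    (A : 'M[F]_n.+1) (ls : seq F) m (p : 'I_m -> 'M[F]_n.+1)
    (c d : 'I_m -> 'I_m -> F) :
  char_poly A = \prod_(x <- ls) ('X - x%:P) ->
  A = \sum_i \sum_j c i j *: (p i *m p j - p j *m p i) ->
  (forall i, A *m p i - p i *m A = \sum_j d i j *: p j) ->
  (forall i j, \tr (p i *m p j) = 0) ->
  forall x, x \in ls -> x = 0.
Proof.
move=> Als AE Ap trp x xls; apply/eqP/negPn/negP => x0.
pose k := size ls; pose l (i : 'I_k) := ls`_i.
have xk : (index x ls < k)%N by rewrite index_mem.
have [|r [i0 ri0] rP] := rational_form charF0 (l := l) (i0 := Ordinal xk).
  by rewrite /l /= nth_index.
have rD i j i' j' : l i - l j = l i' - l j' -> r i - r j = r i' - r j'.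
  move=> E; pose q a : rat := ((a == i)%:R - (a == j)%:R) - ((a == i')%:R - (a ==
    j')%:R).
  have sumd (R : pzRingType) (h : 'I_k -> R) b : \sum_a (a == b)%:R * h a = h b.
    rewrite (bigD1 b) //= eqxx mul1r big1 ?addr0 // => a /negPf->.
    by rewrite mul0r.
  have /rP : \sum_a ratr (q a) * l a = 0.
    transitivity ((l i - l j) - (l i' - l j')); last by rewrite E subrr.
    rewrite -!(sumd F l) -!sumrB; apply: eq_bigr => a _.
    rewrite -!mulrBl; congr (_ * _); rewrite /q.
    by rewrite !pchar0_ratrB // !ratr_nat.
  have -> : \sum_a q a * r a = (r i - r j) - (r i' - r j').
    rewrite -!(sumd rat r) -!sumrB; apply: eq_bigr => a _.
    by rewrite -!mulrBl.
  by move/eqP; rewrite subr_eq0 => /eqP.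
(* By [rD], equal eigenvalues have equal [r i] and equal differences have equal [r i - r j], so the
   index picked is irrelevant. The default 0 is never reached on [ls] or its differences. *)
pose g (y : F) : F := if [pick i | l i == y] is Some i then ratr (r i) else 0.
pose gd (y : F) : F :=
  if [pick ij : 'I_k * 'I_k | l ij.1 - l ij.2 == y] is Some ij
  then ratr (r ij.1) - ratr (r ij.2) else 0.
have gE i : g (l i) = ratr (r i).
  rewrite /g; case: pickP => [j /eqP lj|/(_ i)]; last by rewrite eqxx.
  congr ratr; have /rD : l i - l i = l i - l j by rewrite lj.
  by rewrite subrr => /eqP; rewrite eq_sym subr_eq0 => /eqP.
have lsP y : y \in ls -> exists i, y = l i.
  rewrite -index_mem => yk; exists (Ordinal yk).
  by rewrite /l /= nth_index // -index_mem.
have gdE : {in ls &, forall x y, gd (x - y) = g x - g y}.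
  move=> _ _ /lsP[i ->] /lsP[j ->]; rewrite !gE /gd.
  case: pickP => [[i' j'] /= /eqP /rD|/(_ (i, j)) /=]; last by rewrite eqxx.
  by rewrite -!pchar0_ratrB // => ->.
have [P [Q [QE PE]]] := commutator_poly Als gdE; pose Y := horner_mx A Q.
have [||U UP] := @vspace_of_pred F 'M[F]_n.+1 (fun v =>
  exists e, v = \sum_i e i *: p i).
- by exists (fun=> 0); rewrite big1 // => i _; rewrite scale0r.
- move=> a _ _ [e1 ->] [e2 ->]; exists (fun i => a * e1 i + e2 i).
  rewrite scaler_sumr -big_split; apply: eq_bigr => i _ /=.
  by rewrite scalerDl scalerA.
have pU i : p i \in U.
  apply/UP; exists (fun j => (j == i)%:R).
  rewrite (bigD1 i) //= eqxx scale1r big1 ?addr0 // => j /negPf->.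
  by rewrite scale0r.
have trPp i v : v \in U -> \tr (p i *m v) = 0.
  case/UP => e ->; rewrite mulmx_sumr raddf_sum /= big1 // => j _.
  by rewrite -scalemxAr mxtraceZ trp mulr0.
have PPp i : poly_act (mulmx A \- mulmxr A) P (p i) \in U.
  apply: rpred_sum => j _; apply: rpredZ.
  elim: (val j) => //= t /UP[e ->]; rewrite mulmx_sumr mulmx_suml -sumrB.
  apply: rpred_sum => a _; rewrite -scalemxAr -scalemxAl -scalerBr Ap.
  by apply/rpredZ/rpred_sum => b _; apply/rpredZ.
(* [P (ad A)] preserves the span of the p i, which is isotropic; hence A is
   orthogonal to Y, whose eigenvalues are the rationals r i. *)
have : \tr (A *m Y) = 0.
  rewrite {1}AE mulmx_suml raddf_sum big1 //= => i _.
  rewrite mulmx_suml raddf_sum big1 //= => j _.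
  rewrite -scalemxAl mxtraceZ mulmxBl -(mulmxA (p j)) raddfB /=.
  rewrite [\tr (p j *m _)]mxtrace_mulC -!mulmxA -raddfB -mulmxBr /=.
  rewrite -opprB -/Y -PE mulmxN raddfN /= trPp ?oppr0 ?mulr0 //.
have -> : A *m Y = horner_mx A ('X * Q) by rewrite rmorphM /= horner_mx_X.
rewrite (mxtrace_horner _ Als) (big_nth 0) big_mkord => trAQ.
have /rP : \sum_i ratr (r i) * l i = 0.
  rewrite -[RHS]trAQ; apply: eq_bigr => i _.
  by rewrite hornerM hornerX QE ?mem_nth // -gE mulrC.
move/eqP; rewrite psumr_eq0 => [/allP/(_ i0)|i _]; last by rewrite -expr2 sqr_ge0.
by rewrite mem_index_enum mulf_eq0 orbb (negPf ri0) => /(_ isT).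
Qed.

Lemma max_vspace (K : fieldType) (V : vectType K) (Q : {vspace V} -> Prop) U0 :
  Q U0 -> exists2 U, Q U & forall U', Q U' -> (\dim U' <= \dim U)%N.
Proof.
have [n] := ubnP (dim V - \dim U0); elim: n U0 => // n IHn U0; rewrite ltnS => dU QU.
have [[U1 [QU1 dU1]]|noU] := classic (exists U1, Q U1 /\ (\dim U0 < \dim U1)%N).
  apply: (IHn U1) => //; have := dimvS (subvf U1); rewrite dimvf; lia.
exists U0 => // U1 QU1; rewrite leqNgt; apply/negP => dU1.
by apply: noU; exists U1.
Qed.

Lemma irreducible_factor (K : fieldType) (p : {poly K}) : (1 < size p)%N ->
  exists2 q, irreducible_poly q & q %| p.
Proof.
have [n] := ubnP (size p); elim: n p => // n IHn p; rewrite ltnS => pn p1.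
have [irr|nirr] := classic (irreducible_poly p); first by exists p.
have [[q [q1 qp qNp]]|noq] :=
    classic (exists q : {poly K}, [/\ size q != 1%N, q %| p & ~~ (q %= p)]).
  have p0 : p != 0 by rewrite -size_poly_gt0; lia.
  have q0 : q != 0 by apply: contraTneq qp => ->; rewrite dvd0p.
  have sq : (size q < size p)%N.
    by rewrite ltn_neqAle dvdp_leq // andbT; apply: contra qNp => /eqP sE;
      rewrite -dvdp_size_eqp ?sE.
  have [||r irr_r rq] := IHn q; [lia| |by exists r => //; apply: dvdp_trans qp].
  by have := size_poly_gt0 q; rewrite q0; lia.
case: nirr; split=> // q q1 qp; apply/negPn/negP => qNp.
by apply: noq; exists q.
Qed.

(** One root is adjoined at a time and the base field changes with it, hence the induction
    generalizes over [K] and the result is a field with an embedding. *)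
Lemma splitting_extension (K : fieldType) (p : {poly K}) : p \is monic ->
  exists (F : fieldType) (f : {rmorphism K -> F}) (ls : seq F),
    map_poly f p = \prod_(x <- ls) ('X - x%:P).
Proof.
have [n] := ubnP (size p); elim: n K p => // n IHn K p; rewrite ltnS => pn mp.
have [p1|p1] := leqP (size p) 1.
  exists K, idfun, [::]; rewrite big_nil map_poly_id //.
  have /eqP sp : size p == 1%N by rewrite eqn_leq p1 size_poly_gt0 monic_neq0.
  have /size1_polyC pE : (size p <= 1)%N by [].
  by move: mp; rewrite pE monicE lead_coefC => /eqP->.
have [q irr_q qp] := irreducible_factor p1.
have [L _ [z qz _]] := irredp_FAdjoin irr_q.
have pz : root (map_poly (in_alg L) p) z.
  by case/dvdpP: qp => r ->; rewrite rmorphM /= rootM qz orbT.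
case/factor_theorem: pz => r pE.
have mr : r \is monic.
  by rewrite -(monicMr _ (monicXsubC z)) -pE map_monic.
have [|F [f [ls rE]]] := IHn _ r _ mr.
  have := size_map_poly (in_alg L) p;
    rewrite pE size_mul ?polyXsubC_eq0 ?monic_neq0 // size_XsubC addn2 /= => szp.
  by apply: leq_trans pn; rewrite -szp.
exists F, (f \o in_alg L), (f z :: ls).
rewrite map_poly_comp pE rmorphM /= rE big_cons mulrC.
by rewrite rmorphB /= map_polyX map_polyC.
Qed.

(** * Engel's theorem and perfect Lie algebras of nilpotent matrices *)

Section Perfect.

Variables (K : fieldType) (n : nat).
Implicit Types (P M T U : {vspace 'M[K]_n}).

Definition comm_closed P := forall A B, A \in P -> B \in P -> A *m B - B *m A \in P.

(** The inclusion of [P] in [P, P], expressed through all subspaces that contain the commutators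
    instead of their span. *)
Definition comm_perfect P :=
  forall U, (forall A B, A \in P -> B \in P -> A *m B - B *m A \in U) -> (P <= U)%VS.

(** Engel's theorem for [M] acting by commutators on T / U, a nonzero quotient when [U] is contained
    in [T]: some nonzero class is killed by all of [M]. Keeping [T] and [U] general lets the
    induction apply to [M] modulo a subalgebra. *)
Lemma engel_commutator M T U : comm_closed M ->
  (forall A, A \in M -> exists k, A ^+ k = 0) ->
  (forall A B, A \in M -> B \in T -> A *m B - B *m A \in T) ->
  (forall A B, A \in M -> B \in U -> A *m B - B *m A \in U) ->
  ~~ (T <= U)%VS ->
  exists v, [/\ v \in T, v \notin U & forall A, A \in M -> A *m v - v *m A \in U].
Proof.
have [d] := ubnP (\dim M); elim: d M T U => // d IHd M T U; rewrite ltnS.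
move=> dM Mc Mn MT MU /subvPn[w0 w0T w0U].
have [->|M0] := eqVneq M 0%VS.
  exists w0; split=> // A; rewrite memv0 => /eqP->.
  by rewrite mul0mx mulmx0 subrr mem0v.
(* [M'] is a largest proper subalgebra; the induction hypothesis for its action on M / M' yields [x]
   outside [M'] that normalizes it. *)
have [|M' [M'c M'M dM'] M'max] := @max_vspace _ _
    (fun M' => [/\ comm_closed M', (M' <= M)%VS & (\dim M' < \dim M)%N]) 0%VS.
  split; last 2 first.
  - exact: sub0v.
  - by rewrite dimv0 lt0n dimv_eq0.
  - move=> A B; rewrite !memv0 => /eqP-> /eqP->.
    by rewrite mul0mx subrr.
have M'sub : {subset M' <= M} by apply/subvP.
have M'n A : A \in M' -> exists k, A ^+ k = 0 by move/M'sub/Mn.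
have [||||||x [xM xM' M'x]] := IHd M' M M' => //.
- lia.
- by move=> A B /M'sub; exact: Mc.
- by apply/negP => /dimvS; lia.
have ME : M = (M' + <[x]>)%VS.
  apply/eqP; rewrite eq_sym eqEdim subv_add M'M -memvE xM /=.
  rewrite leqNgt; apply/negP => dMx.
  have /M'max : [/\ comm_closed (M' + <[x]>), (M' + <[x]> <= M)%VS & (\dim (M' +
    <[x]>) < \dim M)%N].
    split=> //; last by rewrite subv_add M'M -memvE.
    move=> _ _ /memv_addP[a aM' [_ /vlineP[k ->] ->]]
      /memv_addP[b bM' [_ /vlineP[l ->] ->]].
    have -> : (a + k *: x) *m (b + l *: x) - (b + l *: x) *m (a + k *: x) =
       ((a *m b - b *m a) + l *: (a *m x - x *m a) - k *: (b *m x - x *m b)).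
      rewrite !mulmxDl !mulmxDr -!scalemxAl -!scalemxAr !scalerBr.
      rewrite scalerA [l *: (k *: _)]scalerA [l * k]mulrC.
      apply/matrixP => i j; rewrite !mxE; ring.
    apply: (subvP (addvSl _ _)).
    apply: rpredB; last by apply/rpredZ/M'x.
    by apply: rpredD; [exact: M'c | apply/rpredZ/M'x].
  have := dimvS (addvSl M' <[x]>); move=> d1 d2.
  have /eqP E : M' == (M' + <[x]>)%VS by rewrite eqEdim addvSl.
  by case/negP: xM'; rewrite E memvE addvSr.
have [||||||w [wT wU M'w]] := IHd M' T U => //.
- lia.
- by move=> A B /M'sub; exact: MT.
- by move=> A B /M'sub; exact: MU.
- by apply/subvPn; exists w0.
have [k xk] := Mn x xM.
pose ad B := x *m B - B *m x.
have ad_nil : iter (k + k) ad w = 0.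
  by apply: iter_commutator; rewrite xk ?mul0mx ?mulmx0.
have exU : exists j, iter j ad w \in U by exists (k + k)%N; rewrite ad_nil mem0v.
(* The classes killed by [M'] are stable under [ad], which is nilpotent; the last iterate outside
   [U] is killed by [x] as well. *)
case: (ex_minnP exU) => [[|j] jU jmin]; first by rewrite (negPf wU) in jU.
have jT i : iter i ad w \in T by elim: i => //= i ?; exact: MT.
have M'j i A : A \in M' -> A *m iter i ad w - iter i ad w *m A \in U.
  elim: i A => [|i IHi] A AM' //=; first exact: M'w.
  set v := iter i ad w.
  have -> : A *m ad v - ad v *m A = ad (A *m v - v *m A)
      + ((A *m x - x *m A) *m v - v *m (A *m x - x *m A)).
    rewrite /ad !(mulmxBl, mulmxBr) !mulmxA.
    by apply/matrixP => a b; rewrite !mxE; ring.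
  by apply: rpredD; [apply/MU/IHi | apply/IHi/M'x].
exists (iter j ad w); split=> //.
  by apply/negP => /jmin; rewrite ltnn.
move=> A; rewrite ME => /memv_addP[a aM' [_ /vlineP[c ->] ->]].
rewrite mulmxDl mulmxDr -scalemxAl -scalemxAr opprD addrACA -scalerBr.
by apply: rpredD; [exact: M'j | apply/rpredZ].
Qed.

(** Modulo a largest proper ideal [U], Engel's theorem gives a central line, so P / U is that line.
    All commutators then lie in [U], against perfectness. *)
Lemma perfect_nilpotent_eq0 P : comm_closed P -> comm_perfect P ->
  (forall A, A \in P -> exists k, A ^+ k = 0) -> P = 0%VS.
Proof.
move=> Pc Pp Pn; apply/eqP/negPn/negP => P0.
pose Q U := [/\ forall A B, A \in P -> B \in U -> A *m B - B *m A \in U,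
  (U <= P)%VS & (\dim U < \dim P)%N].
have [|U [PU UP dU] Umax] := @max_vspace _ _ Q 0%VS.
  split; last 2 first.
  - exact: sub0v.
  - by rewrite dimv0 lt0n dimv_eq0.
  - move=> A B _; rewrite !memv0 => /eqP->.
    by rewrite mulmx0 mul0mx subrr.
have nPU : ~~ (P <= U)%VS by apply/negP => /dimvS; lia.
have [v [vP vU Pv]] := engel_commutator Pc Pn Pc PU nPU.
have PE : P = (U + <[v]>)%VS.
  apply/eqP; rewrite eq_sym eqEdim subv_add UP -memvE vP /=.
  rewrite leqNgt; apply/negP => dUv.
  have /Umax : Q (U + <[v]>)%VS.
    split=> //; last by rewrite subv_add UP -memvE.
    move=> A B AP /memv_addP[b bU [_ /vlineP[l ->] ->]].
    apply: (subvP (addvSl _ _)).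
    rewrite mulmxDl mulmxDr -scalemxAl -scalemxAr opprD addrACA -scalerBr.
    by apply: rpredD; [exact: PU | apply/rpredZ/Pv].
  move=> d2; have /eqP E : U == (U + <[v]>)%VS by rewrite eqEdim addvSl.
  by case/negP: vU; rewrite E memvE addvSr.
case/negP: nPU; apply: Pp => A B AP; rewrite {1}PE.
case/memv_addP=> b bU [_ /vlineP[l ->] ->].
rewrite mulmxDl mulmxDr -scalemxAl -scalemxAr opprD addrACA -scalerBr.
by apply: rpredD; [exact: PU | apply/rpredZ/Pv].
Qed.

End Perfect.

Lemma pchar0_rmorph (K F : fieldType) (f : {rmorphism K -> F}) :
  [pchar K] =i pred0 -> [pchar F] =i pred0.
Proof. by move=> K0 q; rewrite (fmorph_pchar f). Qed.

(** Over a splitting field all eigenvalues of [A] vanish, so its characteristic polynomial is a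
    power of 'X there and hence over [K]; nilpotency follows by Cayley-Hamilton. *)
Lemma cartan_perfect (K : fieldType) (charK0 : [pchar K] =i pred0) n
    (P : {vspace 'M[K]_n}) : comm_closed P -> comm_perfect P ->
  (forall A B, A \in P -> B \in P -> \tr (A *m B) = 0) -> P = 0%VS.
Proof.
case: n P => [|n] P Pc Pp Ptr.
  by apply/eqP; rewrite -subv0; apply/subvP => A _; rewrite [A]thinmx0 mem0v.
apply: (perfect_nilpotent_eq0 Pc Pp) => A AP; exists n.+1.
pose p (i : 'I_(\dim P)) := (vbasis P)`_i.
have pP i : p i \in P by apply: vbasis_mem; rewrite mem_nth ?size_tuple.
have [||U UP] := @vspace_of_pred K 'M[K]_n.+1
    (fun v => exists c : 'I_(\dim P) -> 'I_(\dim P) -> K,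
       v = \sum_i \sum_j c i j *: (p i *m p j - p j *m p i)).
- exists (fun _ _ => 0); rewrite big1 // => i _; rewrite big1 // => j _.
  by rewrite scale0r.
- move=> a _ _ [e1 ->] [e2 ->]; exists (fun i j => a * e1 i j + e2 i j).
  rewrite scaler_sumr -big_split; apply: eq_bigr => i _ /=.
  rewrite scaler_sumr -big_split; apply: eq_bigr => j _ /=.
  by rewrite scalerDl scalerA.
have /Pp /subvP /(_ A AP) /UP [c AE] :
    forall B C, B \in P -> C \in P -> B *m C - C *m B \in U.
  move=> B C BP CP; apply/UP; rewrite (coord_vbasis BP) (coord_vbasis CP).
  exists (fun i j => coord (vbasis P) i B * coord (vbasis P) j C).
  rewrite mulmx_suml mulmx_sumr -sumrB; apply: eq_bigr => i _.
  rewrite mulmx_sumr mulmx_suml -sumrB; apply: eq_bigr => j _.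
  by rewrite -!scalemxAl -!scalemxAr !scalerA [X in _ - X *: _]mulrC scalerBr.
pose d i j := coord (vbasis P) j (A *m p i - p i *m A).
have Ap i : A *m p i - p i *m A = \sum_j d i j *: p j by exact/coord_vbasis/Pc.
have [F [f [ls Als]]] := splitting_extension (char_poly_monic A).
rewrite map_char_poly in Als.
have ls0 : forall x, x \in ls -> x = 0.
  apply: (cartan_split (pchar0_rmorph f charK0) Als
    (p := fun i => map_mx f (p i)) (c := fun i j => f (c i j))
    (d := fun i j => f (d i j))) => [|i|i j].
  - rewrite {1}AE raddf_sum /=; apply: eq_bigr => i _.
    rewrite raddf_sum /=; apply: eq_bigr => j _.
    by rewrite map_mxZ map_mxB !map_mxM.
  - rewrite -!map_mxM -map_mxB Ap raddf_sum /=; apply: eq_bigr => j _.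
    by rewrite map_mxZ.
  - by rewrite -map_mxM trace_map_mx Ptr ?rmorph0.
have sz : size ls = n.+1.
  by have := size_char_poly (map_mx f A); rewrite Als size_prod_XsubC => -[].
have Xn : char_poly A = 'X^(n.+1).
  apply: (map_poly_inj f); rewrite map_char_poly Als map_polyXn -sz.
  rewrite big_seq; rewrite (eq_bigr (fun=> 'X)) => [|x /ls0 ->];
    last by rewrite polyC0 subr0.
  rewrite -big_seq.
  elim: (ls) => [|x s IHs]; first by rewrite big_nil /= expr0.
  by rewrite big_cons IHs /= exprS.
by have := Cayley_Hamilton A; rewrite Xn rmorphXn /= horner_mx_X.
Qed.

(** * Lie algebras and their modules *)

Section Coordinates.

Variables (K : fieldType) (V : vectType K).
Implicit Types (u v : V).

Definition vcoord u i : K := v2r u 0 i.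

Lemma vcoord_inj u v : vcoord u =1 vcoord v -> u = v.
Proof. by move=> uv; apply/v2r_inj/rowP => i; exact: uv. Qed.

Lemma vcoord0 i : vcoord 0 i = 0.
Proof. by rewrite /vcoord linear0 mxE. Qed.
Lemma vcoordD u v i : vcoord (u + v) i = vcoord u i + vcoord v i.
Proof. by rewrite /vcoord linearD mxE. Qed.
Lemma vcoordN u i : vcoord (- u) i = - vcoord u i.
Proof. by rewrite /vcoord linearN mxE. Qed.
Lemma vcoordZ a u i : vcoord (a *: u) i = a * vcoord u i.
Proof. by rewrite /vcoord linearZ mxE. Qed.

End Coordinates.

(* Identities between vectors are checked coordinatewise, where [ring] applies. *)
Ltac vect_ring :=
  apply: vcoord_inj => ?; rewrite ?(vcoordD, vcoordN, vcoordZ, vcoord0);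
  repeat match goal with |- context [vcoord ?u ?i] =>
    let t := fresh "t" in set t := (vcoord u i); clearbody t end;
  ring.

Section LinearFun.

Variables (K : fieldType) (U V : vectType K).

Section Raw.

Variables (f : U -> V) (lf : linear f).

Lemma linear_rawD u v : f (u + v) = f u + f v.
Proof. by have := lf 1 u v; rewrite !scale1r. Qed.

Lemma linear_raw0 : f 0 = 0.
Proof. by apply: (addrI (f 0)); rewrite -linear_rawD !addr0. Qed.

Lemma linear_rawZ a u : f (a *: u) = a *: f u.
Proof. by have := lf a u 0; rewrite linear_raw0 !addr0. Qed.

Lemma linear_rawN u : f (- u) = - f u.
Proof. by rewrite -scaleN1r linear_rawZ scaleN1r. Qed.

Lemma linear_rawB u v : f (u - v) = f u - f v.
Proof. by rewrite linear_rawD linear_rawN. Qed.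

Lemma linear_raw_sum I (r : seq I) (P : pred I) (F : I -> U) :
  f (\sum_(i <- r | P i) F i) = \sum_(i <- r | P i) f (F i).
Proof. exact: (big_morph f linear_rawD linear_raw0). Qed.

Definition hom_of : 'Hom(U, V) :=
  linfun (HB.pack f (GRing.isLinear.Build K U V *:%R f lf) : {linear U -> V}).

Lemma hom_ofE u : hom_of u = f u.
Proof. by rewrite lfunE. Qed.

End Raw.

(* Restating linearity for ['Hom] keeps the scaling in the form used by [vcoordZ]. *)
Lemma homP (h : 'Hom(U, V)) a u v : h (a *: u + v) = a *: h u + h v.
Proof. exact: linearP. Qed.

Lemma mul_f2mx (h : 'Hom(U, V)) u : u *m f2mx h = v2r (h (r2v u)).
Proof. by case: h => A; rewrite unlock /= /fun_of_lfun_def /= !r2vK. Qed.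

Lemma f2mx_linear : linear (@f2mx K U V).
Proof.
move=> a g h; apply/row_matrixP => i; rewrite !rowE mulmxDr -scalemxAr.
by rewrite !mul_f2mx add_lfunE scale_lfunE linearP.
Qed.

End LinearFun.

Section Trace.

Variables (K : fieldType) (V : vectType K).
Implicit Types f g : 'End(V).

Lemma f2mx_comp f g : f2mx (f \o g)%VF = f2mx g *m f2mx f.
Proof.
apply/row_matrixP => i; rewrite !rowE mulmxA.
by rewrite !mul_f2mx comp_lfunE v2rK.
Qed.

Definition ltrace f : K := \tr (f2mx f).

Lemma ltrace_linear : linear_for *%R ltrace.
Proof. by move=> a f g; rewrite /ltrace f2mx_linear linearD /= mxtraceZ. Qed.

Lemma ltraceD f g : ltrace (f + g) = ltrace f + ltrace g.
Proof. by have := ltrace_linear 1 f g; rewrite scale1r mul1r. Qed.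

Lemma ltrace0 : ltrace 0 = 0.
Proof. by apply: (addrI (ltrace 0)); rewrite -ltraceD !addr0. Qed.

Lemma ltraceZ a f : ltrace (a *: f) = a * ltrace f.
Proof. by have := ltrace_linear a f 0; rewrite ltrace0 !addr0. Qed.

Lemma ltraceN f : ltrace (- f) = - ltrace f.
Proof. by rewrite -scaleN1r ltraceZ mulN1r. Qed.

Lemma ltraceB f g : ltrace (f - g) = ltrace f - ltrace g.
Proof. by rewrite ltraceD ltraceN. Qed.

Lemma ltrace_sum I (r : seq I) (P : pred I) (F : I -> 'End(V)) :
  ltrace (\sum_(i <- r | P i) F i) = \sum_(i <- r | P i) ltrace (F i).
Proof. exact: (big_morph ltrace ltraceD ltrace0). Qed.

Lemma ltrace_comp f g : ltrace (f \o g)%VF = ltrace (g \o f)%VF.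
Proof. by rewrite /ltrace !f2mx_comp mxtrace_mulC. Qed.

Lemma ltrace1 : ltrace \1%VF = (\dim {:V})%:R.
Proof.
rewrite /ltrace; suff -> : f2mx (\1%VF : 'End(V)) = 1%:M by rewrite mxtrace1 dimvf.
by apply/row_matrixP => i; rewrite !rowE mul_f2mx id_lfunE r2vK mulmx1.
Qed.

End Trace.

Section Bracket.

Variables (K : fieldType) (L : lieAlgType K).
Implicit Types (x y z : L) (U W I J : {vspace L}).

Lemma lieDl x y z : [lie x + y, z] = [lie x, z] + [lie y, z].
Proof. exact: linear_rawD (lie_bracket_linearl z) x y. Qed.
Lemma lieDr x y z : [lie x, y + z] = [lie x, y] + [lie x, z].
Proof. exact: linear_rawD (lie_bracket_linearr x) y z. Qed.
Lemma lieZl a x y : [lie a *: x, y] = a *: [lie x, y].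
Proof. exact: linear_rawZ (lie_bracket_linearl y) a x. Qed.
Lemma lieZr a x y : [lie x, a *: y] = a *: [lie x, y].
Proof. exact: linear_rawZ (lie_bracket_linearr x) a y. Qed.
Lemma lie0l x : [lie 0, x] = 0.
Proof. exact: linear_raw0 (lie_bracket_linearl x). Qed.
Lemma lie0r x : [lie x, 0] = 0.
Proof. exact: linear_raw0 (lie_bracket_linearr x). Qed.
Lemma lieNl x y : [lie - x, y] = - [lie x, y].
Proof. exact: linear_rawN (lie_bracket_linearl y) x. Qed.
Lemma lieNr x y : [lie x, - y] = - [lie x, y].
Proof. exact: linear_rawN (lie_bracket_linearr x) y. Qed.
Lemma lieBl x y z : [lie x - y, z] = [lie x, z] - [lie y, z].
Proof. by rewrite lieDl lieNl. Qed.
Lemma lieBr x y z : [lie x, y - z] = [lie x, y] - [lie x, z].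
Proof. by rewrite lieDr lieNr. Qed.

Lemma lieC x y : [lie x, y] = - [lie y, x].
Proof.
apply/eqP; rewrite -addr_eq0.
have := lie_bracketxx (x + y); rewrite lieDl !lieDr !lie_bracketxx add0r addr0.
by move=> ->.
Qed.

Lemma lie_jacobil x y z : [lie [lie x, y], z] = [lie x, [lie y, z]] - [lie y, [lie x,
  z]].
Proof.
have := lie_jacobi x y z; rewrite [in X in _ + X]lieC [[lie z, x]]lieC lieNr.
by move/eqP; rewrite subr_eq0 => /eqP <-.
Qed.

Lemma adjoint_module : is_lie_module (@lie_bracket K L).
Proof.
split; [exact: lie_bracket_linearl | exact: lie_bracket_linearr |].
exact: lie_jacobil.
Qed.

Lemma mem_lie_bracketv U W x y : x \in U -> y \in W -> [lie x, y] \in lie_bracketv U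
  W.
Proof.
move=> xU yW; rewrite (coord_vbasis xU) (coord_vbasis yW).
rewrite (linear_raw_sum (lie_bracket_linearl _)); apply: rpred_sum => i _.
rewrite (linear_raw_sum (lie_bracket_linearr _)); apply: rpred_sum => j _.
rewrite lieZl lieZr; do 2!apply: rpredZ; apply: memv_span.
by apply: allpairs_f; rewrite mem_nth ?size_tuple.
Qed.

Lemma lie_bracketv_sub U W (X : {vspace L}) :
  (forall x y, x \in U -> y \in W -> [lie x, y] \in X) -> (lie_bracketv U W <= X)%VS.
Proof.
move=> UWX; apply/span_subvP => _ /allpairsP[[x y] [/= xU yW ->]].
by apply: UWX; apply: vbasis_mem.
Qed.

Lemma lie_idealP I : lie_ideal I <-> (forall x y, y \in I -> [lie x, y] \in I).
Proof.
split=> [/subvP Ii x y yI|Ii]; first by apply/Ii/mem_lie_bracketv; rewrite ?memvf.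
by apply: lie_bracketv_sub => x y _; exact: Ii.
Qed.

Lemma lie_bracketvS U U' W W' : (U <= U')%VS -> (W <= W')%VS ->
  (lie_bracketv U W <= lie_bracketv U' W')%VS.
Proof.
move=> /subvP UU /subvP WW; apply: lie_bracketv_sub => x y /UU xU /WW yW.
exact: mem_lie_bracketv.
Qed.

Lemma lie_derivedS n U W : (U <= W)%VS -> (lie_derived n U <= lie_derived n W)%VS.
Proof. by move=> UW; elim: n => //= n IHn; exact: lie_bracketvS. Qed.

Lemma lie_derivedD m n U : lie_derived (m + n) U = lie_derived m (lie_derived n U).
Proof. by rewrite /lie_derived iterD. Qed.

Lemma lie_derived_ideal n I : lie_ideal I -> lie_ideal (lie_derived n I).
Proof.
elim: n => //= n IHn /IHn /lie_idealP Ii; apply/lie_idealP => x y.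
set D := lie_derived n I in Ii *.
suff /subvP DD : (lie_bracketv D D <= (hom_of (lie_bracket_linearr x)) @^-1:
  lie_bracketv D D)%VS.
  by move=> /DD; rewrite -memv_preim hom_ofE.
apply: lie_bracketv_sub => u v uD vD; rewrite -memv_preim hom_ofE.
have -> : [lie x, [lie u, v]] = [lie [lie x, u], v] + [lie u, [lie x, v]].
  by rewrite lie_jacobil subrK.
by apply: rpredD; apply: mem_lie_bracketv => //; exact: Ii.
Qed.

Lemma lie_derived_le n I : (forall x y, x \in I -> y \in I -> [lie x, y] \in I) ->
  (lie_derived n I <= I)%VS.
Proof.
move=> Ic; elim: n => [|n IHn] /=; first exact: subvv.
by apply: subv_trans (lie_bracketvS IHn IHn) _; apply: lie_bracketv_sub.
Qed.

End Bracket.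

Section Module.

Variables (K : fieldType) (L : lieAlgType K) (V : vectType K).
Variables (act : L -> V -> V) (mod_act : is_lie_module act).
Implicit Types (x y z : L) (u v : V) (I : {vspace L}).

Lemma actDl x y v : act (x + y) v = act x v + act y v.
Proof. exact: linear_rawD (lie_act_linearl mod_act v) x y. Qed.
Lemma actZl a x v : act (a *: x) v = a *: act x v.
Proof. exact: linear_rawZ (lie_act_linearl mod_act v) a x. Qed.
Lemma actNl x v : act (- x) v = - act x v.
Proof. exact: linear_rawN (lie_act_linearl mod_act v) x. Qed.
Lemma actBl x y v : act (x - y) v = act x v - act y v.
Proof. by rewrite actDl actNl. Qed.
Lemma act0l v : act 0 v = 0.
Proof. exact: linear_raw0 (lie_act_linearl mod_act v). Qed.
Lemma actDr x u v : act x (u + v) = act x u + act x v.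
Proof. exact: linear_rawD (lie_act_linearr mod_act x) u v. Qed.
Lemma actZr a x v : act x (a *: v) = a *: act x v.
Proof. exact: linear_rawZ (lie_act_linearr mod_act x) a v. Qed.
Lemma actNr x v : act x (- v) = - act x v.
Proof. exact: linear_rawN (lie_act_linearr mod_act x) v. Qed.
Lemma actBr x u v : act x (u - v) = act x u - act x v.
Proof. by rewrite actDr actNr. Qed.
Lemma act0r x : act x 0 = 0.
Proof. exact: linear_raw0 (lie_act_linearr mod_act x). Qed.
Lemma act_sumr x J (r : seq J) (P : pred J) (F : J -> V) :
  act x (\sum_(i <- r | P i) F i) = \sum_(i <- r | P i) act x (F i).
Proof. exact/linear_raw_sum/(lie_act_linearr mod_act). Qed.

Definition act_hom x : 'End(V) := hom_of (lie_act_linearr mod_act x).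

Lemma act_homE x v : act_hom x v = act x v.
Proof. exact: hom_ofE. Qed.

Lemma act_hom_linear : linear act_hom.
Proof.
move=> a x y; apply/lfunP => v.
by rewrite add_lfunE scale_lfunE !act_homE actDl actZl.
Qed.

Lemma act_hom_bracket x y :
  act_hom [lie x, y] = ((act_hom x \o act_hom y) - (act_hom y \o act_hom x))%VF.
Proof.
apply/lfunP => v.
by rewrite add_lfunE opp_lfunE !comp_lfunE !act_homE (lie_act_bracket mod_act).
Qed.

Definition trace_form x y : K := ltrace (act_hom x \o act_hom y)%VF.

Lemma trace_formC x y : trace_form x y = trace_form y x.
Proof. exact: ltrace_comp. Qed.

Lemma trace_form_linear a x y z :
  trace_form (a *: x + y) z = a * trace_form x z + trace_form y z.
Proof.
by rewrite /trace_form act_hom_linear comp_lfunDl -comp_lfunZl ltrace_linear.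
Qed.

Lemma trace_form_invariant x y z : trace_form [lie x, y] z = trace_form x [lie y, z].
Proof.
rewrite /trace_form !act_hom_bracket comp_lfunDl comp_lfunDr comp_lfunNl comp_lfunNr.
rewrite !ltraceB -!comp_lfunA; congr (_ - _).
by rewrite ltrace_comp -comp_lfunA.
Qed.

Lemma lie_derived_stable (I : {vspace L}) : (forall x y, x \in I -> y \in I -> [lie
  x, y] \in I) ->
  exists n, lie_derived n.+1 I = lie_derived n I.
Proof.
move=> Ic; have sub n : (lie_derived n.+1 I <= lie_derived n I)%VS.
  elim: n => [|n IHn] /=; first by apply: lie_bracketv_sub.
  exact: lie_bracketvS.
apply: NNPP => noN; suff dimD n : (\dim (lie_derived n I) + n <= \dim I)%N.
  by have := dimD (\dim I).+1; lia.
elim: n => [|n IHn]; first by rewrite addn0.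
have /dimv_leqif_eq/ltn_leqif := sub n.
rewrite (_ : (_ == _) = false); first lia.
by apply/eqP => E; apply: noN; exists n.
Qed.

(** The derived series stabilizes at a perfect term, whose matrices form a perfect algebra isotropic
    for the trace, hence zero. *)
Lemma cartan_criterion (charK0 : [pchar K] =i pred0) I :
  (forall x y, x \in I -> y \in I -> [lie x, y] \in I) ->
  (forall x y, x \in I -> y \in I -> trace_form x y = 0) ->
  exists n, forall x v, x \in lie_derived n I -> act x v = 0.
Proof.
move=> Ic Itr; have [n Dn] := lie_derived_stable Ic; exists n.
pose mat x := f2mx (act_hom x).
have mat_lin : linear mat by move=> a x y; rewrite /mat act_hom_linear f2mx_linear.
(* Matrices act on row vectors, so [mat] reverses products; this explains the swapped bracket. *)
have matB x y : mat x *m mat y - mat y *m mat x = mat [lie y, x].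
  rewrite /mat act_hom_bracket -!f2mx_comp.
  by have /linear_rawB -> := @f2mx_linear K V V.
pose P := (hom_of mat_lin @: lie_derived n I)%VS.
have matP x : x \in lie_derived n I -> mat x \in P.
  by move=> xD; rewrite -(hom_ofE mat_lin); apply: memv_img.
have PE A : A \in P -> exists2 x, x \in lie_derived n I & A = mat x.
  by case/memv_imgP => x xD ->; exists x; rewrite ?hom_ofE.
have DI : {subset lie_derived n I <= I} by apply/subvP/lie_derived_le.
have Dc x y : x \in lie_derived n I -> y \in lie_derived n I ->
    [lie x, y] \in lie_derived n I.
  by move=> xD yD; rewrite -Dn; apply: mem_lie_bracketv.
suff P0 : P = 0%VS.
  move=> x v xD; have := matP x xD; rewrite P0 memv0 => /eqP x0.
  by apply: v2r_inj; rewrite -act_homE -[v]v2rK -mul_f2mx -/(mat x) x0 mulmx0 linear0.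
apply: (cartan_perfect charK0) => [A B|U UP|A B].
- by case/PE=> x xD -> /PE[y yD ->]; rewrite matB matP ?Dc.
- apply/subvP => _ /PE[x + ->]; rewrite -Dn /= => xD.
  have /subvP/(_ _ xD) : (lie_bracketv (lie_derived n I) (lie_derived n I) <=
      hom_of mat_lin @^-1: U)%VS.
    apply: lie_bracketv_sub => y z yD zD; rewrite -memv_preim hom_ofE.
    by rewrite -matB UP ?matP.
  by rewrite -memv_preim hom_ofE.
- case/PE=> x xD -> /PE[y yD ->]; rewrite /mat -f2mx_comp.
  by apply: Itr; apply: DI.
Qed.

Definition act_stable (U : {vspace V}) := forall x v, v \in U -> act x v \in U.

(** T / U is carried by a complement of [U] in [T]. The map [pi] is defined on all of [V] but is
    meaningful only on [T]; its section [s] is linear, in general not equivariant. *)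
Lemma subquotient_module (T U : {vspace V}) :
  act_stable T -> act_stable U -> (U <= T)%VS ->
  exists (A : vectType K) (actA : L -> A -> A) (pi : 'Hom(V, A)) (s : 'Hom(A, V)),
  [/\ is_lie_module actA, forall a, s a \in T /\ pi (s a) = a,
      forall v, v \in T -> (pi v = 0 <-> v \in U),
      forall x v, v \in T -> pi (act x v) = actA x (pi v) &
      (\dim {:A} + \dim U = \dim T)%N].
Proof.
move=> Ts Us UT; pose C := (T :\: U)%VS.
have CU : (C :&: U = 0)%VS := capv_diff T U.
have CT : {subset C <= T} by apply/subvP/diffvSl.
have CUT : (C + U)%VS = T by rewrite /C addv_diff; apply/addv_idPl.
pose s : 'Hom(subvs_of C, V) := linfun vsval.
pose pi : 'Hom(V, subvs_of C) := (linfun (vsproj C) \o daddv_pi C U)%VF.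
have sT a : s a \in T by rewrite lfunE; apply/CT/subvsP.
have piE v : s (pi v) = daddv_pi C U v.
  by rewrite lfunE /= comp_lfunE lfunE /= vsprojK // memv_pi.
have pis a : pi (s a) = a.
  by apply: subvs_inj; rewrite -[LHS]lfunE -/s piE lfunE /= daddv_pi_id ?subvsP.
have spi v : v \in T -> s (pi v) - v \in U.
  move=> vT; have /(daddv_pi_add CU) : v \in (C + U)%VS by rewrite CUT.
  by rewrite piE => {2}<-; rewrite opprD addNKr memvN memv_pi.
have ker v : v \in T -> (pi v = 0 <-> v \in U).
  move=> vT; split=> [pv0|vU].
    by have := spi v vT; rewrite pv0 linear0 sub0r memvN.
  have : s (pi v) \in (C :&: U)%VS.
    rewrite memv_cap piE memv_pi /= -piE.
    by rewrite -[s _](subrK v) rpredD // spi.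
  by rewrite CU memv0 => /eqP s0; rewrite -[LHS]pis s0 linear0.
have act_pi x v : v \in T -> pi (act x v) = pi (act x (s (pi v))).
  move=> vT; apply/eqP; rewrite eq_sym -subr_eq0 -linearB -actBr; apply/eqP.
  by apply/ker; [apply/Ts/rpredB | apply/Us/spi].
exists (subvs_of C), (fun x a => pi (act x (s a))), pi, s; split=> //.
- split=> [a c x y|x c a b|x y a].
  + by rewrite actDl actZl linearP.
  + by rewrite linearP actDr actZr linearP.
  + rewrite (lie_act_bracket mod_act) linearB /=.
    by congr (_ - _); apply: act_pi; apply: Ts.
- rewrite dimvf /= -[in RHS]CUT dimv_disjoint_sum //.
Qed.

End Module.

Lemma quotient_lie (K : fieldType) (L : lieAlgType K) (I : {vspace L}) : lie_ideal I
  ->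
  exists (S : lieAlgType K) (p : 'Hom(L, S)) (s : 'Hom(S, L)),
  [/\ forall a, p (s a) = a, forall x, p x = 0 <-> x \in I &
      forall x y, p [lie x, y] = [lie p x, p y]].
Proof.
move=> /lie_idealP Ii.
have [|A [actA [p [s [mA sP pI pact _]]]]] :=
  @subquotient_module _ _ _ _ (adjoint_module L) fullv I _ Ii (subvf I);
    first by move=> x v _; rewrite memvf.
have ps a : p (s a) = a by have [] := sP a.
have pB x y : p [lie x, y] = p [lie s (p x), s (p y)].
  rewrite pact ?memvf // -{1}[p y]ps -pact ?memvf //.
  rewrite lieC [[lie s (p x), _]]lieC !linearN /= pact ?memvf //.
  by rewrite -{1}[p x]ps -pact ?memvf.
pose br a b := p [lie s a, s b].
have br_linl b : linear (br^~ b) by move=> c a a';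
  rewrite /br linearP lieDl lieZl linearP.
have br_linr b : linear (br b) by move=> c a a';
  rewrite /br linearP lieDr lieZr linearP.
have brxx a : br a a = 0 by rewrite /br lie_bracketxx linear0.
have brJ a b c : br a (br b c) + br b (br c a) + br c (br a b) = 0.
  have psB x y : p [lie s x, s (p y)] = p [lie s x, y] by rewrite [RHS]pB ps.
  by rewrite /br !psB -!linearD lie_jacobi linear0.
pose S : lieAlgType K := HB.pack A
  (Vector_isLieAlgebra.Build K A br_linl br_linr brxx brJ).
by exists S, p, s; split=> // x; apply: pI; rewrite memvf.
Qed.

(** * Whitehead's second lemma *)

Section Cocycle.

Variables (K : fieldType) (L : lieAlgType K) (V : vectType K).
Variable (act : L -> V -> V).

(** Degree-two cochains in curried form, with the signs that [ce_diff] produces; [ce_cohomology2]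
    makes the translation. *)
Record cocycle2 (f : L -> L -> V) : Prop := Cocycle2 {
  cocycle2_linearl : forall y, linear (f^~ y);
  cocycle2_linearr : forall x, linear (f x);
  cocycle2xx : forall x, f x x = 0;
  cocycle2_eq : forall x y z,
    act x (f y z) - act y (f x z) + act z (f x y)
      - f [lie x, y] z + f [lie x, z] y - f [lie y, z] x = 0
}.

Definition coboundary2 (f : L -> L -> V) : Prop :=
  exists2 g : L -> V, linear g &
    forall x y, f x y = act x (g y) - act y (g x) - g [lie x, y].

Definition cohomology2_zero : Prop := forall f, cocycle2 f -> coboundary2 f.

Definition cocycle1 (g : L -> V) : Prop :=
  linear g /\ forall x y, g [lie x, y] = act x (g y) - act y (g x).

Lemma cocycle2C f x y : cocycle2 f -> f x y = - f y x.
Proof.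
case=> fl fr f0 _; apply/eqP; rewrite -addr_eq0.
have := f0 (x + y); rewrite (linear_rawD (fl _)) !(linear_rawD (fr _)) !f0.
by rewrite add0r addr0 => ->.
Qed.

End Cocycle.

(** * Invariant symmetric forms and the Casimir tensor *)

Section Form.

Variables (K : fieldType) (L : lieAlgType K) (B : L -> L -> K).
Hypothesis B_lin : forall a x y z, B (a *: x + y) z = a * B x z + B y z.
Hypothesis BC : forall x y, B x y = B y x.
Hypothesis B_inv : forall x y z, B [lie x, y] z = B x [lie y, z].
Implicit Types (x y z : L) (I U : {vspace L}).

Definition nondegenerate_on U :=
  forall x, x \in U -> (forall y, y \in U -> B x y = 0) -> x = 0.

Lemma form0l z : B 0 z = 0.
Proof. by have := B_lin 1 0 0 z; rewrite scale1r addr0 mul1r => E;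
  apply: (addrI (B 0 z)); rewrite -E addr0. Qed.
Lemma formDl x y z : B (x + y) z = B x z + B y z.
Proof. by have := B_lin 1 x y z; rewrite scale1r mul1r. Qed.
Lemma formZl a x z : B (a *: x) z = a * B x z.
Proof. by have := B_lin a x 0 z; rewrite form0l !addr0. Qed.
Lemma formNl x z : B (- x) z = - B x z.
Proof. by rewrite -scaleN1r formZl mulN1r. Qed.
Lemma form_suml J (r : seq J) (P : pred J) (F : J -> L) z :
  B (\sum_(i <- r | P i) F i) z = \sum_(i <- r | P i) B (F i) z.
Proof. exact: (big_morph (B^~ z) (fun x y => formDl x y z) (form0l z)). Qed.
Lemma formDr x y z : B z (x + y) = B z x + B z y.
Proof. by rewrite BC formDl !(BC z). Qed.
Lemma formZr a x z : B z (a *: x) = a * B z x.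
Proof. by rewrite BC formZl BC. Qed.
Lemma form_sumr J (r : seq J) (P : pred J) (F : J -> L) z :
  B z (\sum_(i <- r | P i) F i) = \sum_(i <- r | P i) B z (F i).
Proof. by rewrite BC form_suml; apply: eq_bigr => i _; rewrite BC. Qed.

(** Nondegeneracy makes the Gram matrix of a basis invertible; its inverse gives the dual basis. *)
Lemma dual_bases U : nondegenerate_on U ->
  exists e e' : 'I_(\dim U) -> L,
  [/\ forall i, e i \in U /\ e' i \in U,
      forall i j, B (e i) (e' j) = (i == j)%:R,
      forall v, v \in U -> v = \sum_i B v (e' i) *: e i &
      forall v, v \in U -> v = \sum_i B v (e i) *: e' i].
Proof.
move=> Und; pose e (i : 'I_(\dim U)) := (vbasis U)`_i.
have eU i : e i \in U by apply: vbasis_mem; rewrite mem_nth ?size_tuple.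
pose G := \matrix_(i, j) B (e i) (e j).
have Ge v : v \in U -> (forall j, B v (e j) = 0) -> v = 0.
  move=> vU v0; apply: Und => // y /coord_vbasis ->.
  by rewrite form_sumr big1 // => i _; rewrite formZr v0 mulr0.
have Gu : G \in unitmx.
  rewrite -row_free_unit -kermx_eq0; apply/eqP/row_matrixP => i; rewrite row0.
  set u := row i _; have uG : u *m G = 0 by rewrite -row_mul mulmx_ker row0.
  have v0 : \sum_j u 0 j *: e j = 0.
    apply: Ge => [|j]; first by apply: rpred_sum => j _; apply: rpredZ.
    have := congr1 (fun N : 'rV_(\dim U) => N 0 j) uG; rewrite !mxE => <-.
    by rewrite form_suml; apply: eq_bigr => k _; rewrite formZl [G _ _]mxE.
  apply/rowP => j; rewrite [RHS]mxE.
  by have /freeP/(_ (fun j => u 0 j) v0 j) := basis_free (vbasisP U).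
pose e' j := \sum_k invmx G k j *: e k.
have e'U j : e' j \in U by apply: rpred_sum => k _; apply: rpredZ.
have ee' i j : B (e i) (e' j) = (i == j)%:R.
  have := congr1 (fun N : 'M_(\dim U) => N i j) (mulmxV Gu); rewrite !mxE => <-.
  by rewrite form_sumr; apply: eq_bigr => k _; rewrite formZr [G _ _]mxE mulrC.
exists e, e'; split=> [//|//|v vU|v vU].
  rewrite {1}(coord_vbasis vU); apply: eq_bigr => i _; congr (_ *: _).
  rewrite {2}(coord_vbasis vU) form_suml (bigD1 i) //= formZl ee' eqxx mulr1.
  by rewrite big1 ?addr0 // => j /negPf ji; rewrite formZl ee' ji mulr0.
apply/eqP; rewrite -subr_eq0; apply/eqP/Ge => [|j].
  by apply: rpredB => //; apply: rpred_sum => k _; apply: rpredZ.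
rewrite formDl formNl form_suml (bigD1 j) //= formZl [B (e' j) _]BC ee' eqxx.
rewrite mulr1 big1 ?addr0 ?subrr // => i /negPf ij.
by rewrite formZl [B (e' i) _]BC ee' eq_sym ij mulr0.
Qed.

Lemma ideal_radical I : lie_ideal I ->
  exists R : {vspace L}, [/\ lie_ideal R, (R <= I)%VS,
    forall x y, x \in R -> y \in R -> B x y = 0 &
    forall x, x \in I -> (forall y, y \in I -> B x y = 0) -> x \in R].
Proof.
move=> /lie_idealP Ii.
have [||R RP] := @vspace_of_pred K L
    (fun x => x \in I /\ forall y, y \in I -> B x y = 0).
- by split=> [|y _]; rewrite ?mem0v ?form0l.
- move=> a u v [uI u0] [vI v0]; split=> [|y yI]; first by rewrite rpredD ?rpredZ.
  by rewrite B_lin u0 ?v0 // mulr0 addr0.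
exists R; split=> [||x y|x xI x0]; last by apply/RP.
- apply/lie_idealP => x y /RP[yI y0]; apply/RP; split=> [|z zI]; first exact: Ii.
  by rewrite lieC formNl B_inv y0 ?oppr0 ?Ii.
- by apply/subvP => x /RP[].
- by move=> /RP[_ x0] /RP[yI _]; exact: x0.
Qed.

Section CasimirTensor.

Variables (I : {vspace L}) (e e' : 'I_(\dim I) -> L).
Hypothesis Ii : lie_ideal I.
Hypothesis eI : forall i, e i \in I /\ e' i \in I.
Hypothesis eP : forall v, v \in I -> v = \sum_i B v (e' i) *: e i.
Hypothesis e'P : forall v, v \in I -> v = \sum_i B v (e i) *: e' i.

(** By invariance of [B], the matrices of [ad x] in the two dual bases are negative transposes, so
    [x] annihilates the tensor of the pairs [e i], [e' i]. The bilinear [b] stands for a map out of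
    the tensor square. *)
Lemma casimir_tensor_invariant (W : vectType K) (b : L -> L -> W) x :
  (forall y, linear (b^~ y)) -> (forall y, linear (b y)) ->
  \sum_i (b [lie x, e i] (e' i) + b (e i) [lie x, e' i]) = 0.
Proof.
move=> bl br; move/lie_idealP: Ii => Ii'.
have lhs i : b [lie x, e i] (e' i) = \sum_j B [lie x, e i] (e' j) *: b (e j) (e' i).
  rewrite {1}[ [lie x, e i] ]eP ?Ii' ?(eI i).1 // (linear_raw_sum (bl _)).
  by apply: eq_bigr => j _; rewrite (linear_rawZ (bl _)).
have rhs i : b (e i) [lie x, e' i] = \sum_j B [lie x, e' i] (e j) *: b (e i) (e' j).
  rewrite {1}[ [lie x, e' i] ]e'P ?Ii' ?(eI i).2 // (linear_raw_sum (br _)).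
  by apply: eq_bigr => j _; rewrite (linear_rawZ (br _)).
under eq_bigr do rewrite lhs rhs.
rewrite big_split /= [X in _ + X]exchange_big -big_split big1 // => i _ /=.
rewrite -big_split big1 // => j _ /=; rewrite -scalerDl.
by rewrite [[lie x, e i]]lieC formNl B_inv [B (e i) _]BC addNr scale0r.
Qed.

End CasimirTensor.

End Form.

Section CocycleOps.

Variables (K : fieldType) (L : lieAlgType K) (V : vectType K).
Variables (act : L -> V -> V) (mod_act : is_lie_module act).

Lemma cocycle2_diff g : linear g ->
  cocycle2 act (fun x y => act x (g y) - act y (g x) - g [lie x, y]).
Proof.
move=> lg; have gD := linear_rawD lg; have gB := linear_rawB lg.
have gN := linear_rawN lg.
split=> [y a x x'|x a y y'|x|x y z].
- rewrite actDl // actZl // lieDl lieZl !lg actDr // actZr //.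
  by vect_ring.
- rewrite actDl // actZl // lieDr lieZr !lg actDr // actZr //.
  by vect_ring.
- by rewrite lie_bracketxx (linear_raw0 lg) subrr subr0.
- have -> : g [lie [lie x, y], z] = g [lie x, [lie y, z]] - g [lie y, [lie x, z]].
    by rewrite -gB -lie_jacobil.
  rewrite [[lie [lie x, z], y]]lieC [[lie [lie y, z], x]]lieC !gN.
  rewrite !actBr // !(lie_act_bracket mod_act).
  by vect_ring.
Qed.

Lemma cocycle2B f f' : cocycle2 act f -> cocycle2 act f' ->
  cocycle2 act (fun x y => f x y - f' x y).
Proof.
move=> [fl fr fx fc] [fl' fr' fx' fc'].
split=> [y a x x'|x a y y'|x|x y z].
- by rewrite fl fl'; vect_ring.
- by rewrite fr fr'; vect_ring.
- by rewrite fx fx' subrr.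
- rewrite !actBr //; rewrite -[RHS](subr0 0) -{1}(fc x y z) -(fc' x y z).
  by vect_ring.
Qed.

Lemma cocycle2_map (A : vectType K) (actA : L -> A -> A) (T : {vspace V})
    (pi : 'Hom(V, A)) f :
  (forall x v, v \in T -> pi (act x v) = actA x (pi v)) ->
  (forall x y, f x y \in T) -> cocycle2 act f ->
  cocycle2 actA (fun x y => pi (f x y)).
Proof.
move=> piT fT [fl fr fx fc]; split=> [y a x x'|x a y y'|x|x y z].
- by rewrite fl linearP.
- by rewrite fr linearP.
- by rewrite fx linear0.
- by rewrite -!piT // -!(linearD, linearB) fc linear0.
Qed.

End CocycleOps.

Section Casimir.

Variables (K : fieldType) (L : lieAlgType K) (V : vectType K).
Variables (act : L -> V -> V) (mod_act : is_lie_module act).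

(* Contracting a cocycle with the Casimir tensor gives a homotopy between the
   Casimir operator and zero in degree two. *)
Lemma casimir (J : {vspace L}) : lie_ideal J ->
  nondegenerate_on (trace_form mod_act) J ->
  exists c : 'End(V), [/\ forall x v, c (act x v) = act x (c v),
    ltrace c = (\dim J)%:R & forall f, cocycle2 act f -> exists2 g, linear g &
      forall x y, c (f x y) = act x (g y) - act y (g x) - g [lie x, y]].
Proof.
move=> Ji Jnd.
have Blin := trace_form_linear mod_act; have BC := trace_formC mod_act.
have Binv := trace_form_invariant mod_act.
have [e [e' [eJ ee' eP e'P]]] := dual_bases Blin BC Jnd.
have tensor0 := casimir_tensor_invariant Blin BC Binv Ji eJ eP e'P.
pose c := \sum_i (act_hom mod_act (e i) \o act_hom mod_act (e' i))%VF.
have cE v : c v = \sum_i act (e i) (act (e' i) v).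
  by rewrite sum_lfunE; apply: eq_bigr => i _; rewrite comp_lfunE !act_homE.
exists c; split=> [x v||f cf].
- have t0 := tensor0 _ (fun y z => act y (act z v)) x.
  have {}t0 := t0 (fun z => lie_act_linearl mod_act (act z v)).
  have br y : linear (fun z => act y (act z v)).
    by move=> a z z'; rewrite actDl // actZl // actDr // actZr.
  have {}t0 := t0 br.
  apply/eqP; rewrite eq_sym -subr_eq0 !cE act_sumr // -sumrB; apply/eqP.
  rewrite -[RHS]t0; apply: eq_bigr => i _; rewrite !(lie_act_bracket mod_act).
  rewrite actBr //; vect_ring.
- rewrite ltrace_sum (eq_bigr (fun=> 1)) => [|i _].
    by rewrite sumr_const card_ord.
  by have := ee' i i; rewrite eqxx.
- have [fl fr fx fc] := cf.
  exists (fun x => \sum_i act (e i) (f (e' i) x)) => [a x y|x y].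
    rewrite scaler_sumr -big_split; apply: eq_bigr => i _ /=.
    by rewrite fr actDr // actZr.
  (* After the cocycle identity at [e' i], [x], [y] is subtracted, what remains is the invariance of
     the tensor paired with [f _ y] and moved by [x], against the same with [x] and [y]
     exchanged. *)
  have t1 := tensor0 _ (fun u v => act u (f v y)) x.
  have {}t1 := t1 (fun z => lie_act_linearl mod_act (f z y)).
  have br w u : linear (fun z => act u (f z w)).
    by move=> a z z'; rewrite fl actDr // actZr.
  have {}t1 := t1 (br y).
  have t2 := tensor0 _ (fun u v => act u (f v x)) y.
  have {}t2 := t2 (fun z => lie_act_linearl mod_act (f z x)).
  have {}t2 := t2 (br x).
  have /= t12 := congr2 (fun u v : V => v - u) t1 t2; rewrite subrr -sumrB in t12.
  apply/eqP; rewrite -subr_eq0 cE /= !act_sumr // -!sumrB; apply/eqP.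
  rewrite -[RHS]t12; apply: eq_bigr => i _; apply/eqP; rewrite -subr_eq0; apply/eqP.
  rewrite -[RHS](act0r mod_act (e i)) -(fc (e' i) x y).
  rewrite !(actDr mod_act, actNr mod_act) !(lie_act_bracket mod_act).
  rewrite (cocycle2C [lie x, y] (e' i) cf) [[lie x, e' i]]lieC [[lie y, e' i]]lieC.
  rewrite !(linear_rawN (fl _)) !(actNr mod_act).
  by vect_ring.
Qed.

End Casimir.

(** * The Killing form of a semisimple algebra and its second cohomology *)

Section Whitehead.

Variables (K : fieldType) (L : lieAlgType K).
Hypothesis charK0 : [pchar K] =i pred0.
Hypothesis ssL : lie_semisimple L.
Implicit Types (I J : {vspace L}).

Notation killing := (trace_form (adjoint_module L)).

Let kil_lin := trace_form_linear (adjoint_module L).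
Let kilC := trace_formC (adjoint_module L).
Let kil_inv := trace_form_invariant (adjoint_module L).

Lemma semisimple_solvable I : lie_ideal I -> lie_solvable I -> I = 0%VS.
Proof. by have [_ _ H] := ssL => /H + /[dup] => /[apply] + _;
  rewrite subv0 => /eqP. Qed.

(** Cartan's criterion puts a derived term of the isotropic ideal in the kernel of the action;
    faithfulness makes the ideal solvable. *)
Lemma trace_form_solvable (V : vectType K) (act : L -> V -> V)
    (mod_act : is_lie_module act) I : lie_ideal I ->
  (forall x y, x \in I -> y \in I -> trace_form mod_act x y = 0) ->
  (forall x, x \in I -> (forall v, act x v = 0) -> x = 0) -> I = 0%VS.
Proof.
move=> Ii I0 Ifaithful; apply: semisimple_solvable => //.
have Ic x y : x \in I -> y \in I -> [lie x, y] \in I.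
  by move=> _ yI; move/lie_idealP: Ii; apply.
have [n Dn] := cartan_criterion charK0 Ic I0; exists n.
apply/eqP; rewrite -subv0; apply/subvP => x xD; rewrite memv0; apply/eqP.
apply: Ifaithful => [|v]; last exact: Dn.
exact: (subvP (lie_derived_le n Ic)).
Qed.

Lemma semisimple_center (x : L) : (forall y, [lie x, y] = 0) -> x = 0.
Proof.
move=> x0; have xy k y : [lie y, k *: x] = 0 by rewrite lieC lieZl x0 scaler0 oppr0.
suff /eqP : <[x]>%VS = 0%VS by rewrite -subv0 -memvE memv0 => /eqP.
apply: semisimple_solvable.
  by apply/lie_idealP => y _ /vlineP[k ->]; rewrite xy mem0v.
exists 1%N; apply/eqP; rewrite -subv0; apply: lie_bracketv_sub => y z _ /vlineP[k ->].
by rewrite xy mem0v.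
Qed.

Lemma killing_nondegenerate I : lie_ideal I -> nondegenerate_on killing I.
Proof.
move=> Ii; have [R [Ri RI R0 IR]] := ideal_radical kil_lin kil_inv Ii.
move=> x xI x0; have xR : x \in R by exact: IR.
suff R_0 : R = 0%VS by move: xR; rewrite R_0 memv0 => /eqP.
by apply: (trace_form_solvable Ri R0) => y _ /semisimple_center.
Qed.

(** [J] is the orthogonal of [I]; nondegeneracy on [I] gives the projection through dual bases. *)
Lemma killing_complement I : lie_ideal I ->
  exists J, [/\ lie_ideal J, (I :&: J = 0)%VS &
    forall x, exists2 y, y \in I & x - y \in J].
Proof.
move=> Ii; have [||J JP] := @vspace_of_pred K L (fun x =>
  forall y, y \in I -> killing x y = 0).
- by move=> y _; rewrite (form0l kil_lin).
- by move=> a u v u0 v0 y yI; rewrite kil_lin u0 ?v0 // mulr0 addr0.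
have [e [e' [eI ee' eP e'P]]] := dual_bases kil_lin kilC (killing_nondegenerate Ii).
exists J; split.
- apply/lie_idealP => x y /JP y0; apply/JP => z zI.
  by rewrite lieC (formNl kil_lin) kil_inv y0 ?oppr0 //; move/lie_idealP: Ii; apply.
- apply/eqP; rewrite -subv0; apply/subvP => x; rewrite memv_cap => /andP[xI /JP xJ].
  by rewrite memv0; apply/eqP/(killing_nondegenerate Ii).
- move=> x; exists (\sum_i killing x (e' i) *: e i).
    by apply: rpred_sum => i _; apply/rpredZ/(eI i).1.
  apply/JP => y yI; rewrite (formDl kil_lin) (formNl kil_lin) (form_suml kil_lin).
  have -> : killing x y = \sum_i killing x (e' i) * killing y (e i).
    rewrite {1}(e'P _ yI) (form_sumr kil_lin kilC); apply: eq_bigr => i _.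
    by rewrite (formZr kil_lin kilC) mulrC.
  by rewrite -sumrB big1 // => i _;
    rewrite (formZl kil_lin) [killing (e i) y]kilC subrr.
Qed.

(** [J] is a complement of the kernel of the action, so it acts faithfully, and the radical of the
    trace form on [J] vanishes. *)
Lemma trace_form_nondegenerate_ideal (V : vectType K) (act : L -> V -> V)
    (mod_act : is_lie_module act) x0 v0 : act x0 v0 != 0 ->
  exists J, [/\ lie_ideal J, J != 0%VS & nondegenerate_on (trace_form mod_act) J].
Proof.
move=> xv0; have [||I IP] := @vspace_of_pred K L (fun x => forall v, act x v = 0).
- by move=> v; rewrite act0l.
- by move=> a x y x_0 y_0 v; rewrite actDl // actZl // x_0 y_0 scaler0 addr0.
have Ii : lie_ideal I.
  apply/lie_idealP => x y /IP y0; apply/IP => v.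
  by rewrite (lie_act_bracket mod_act) !y0 act0r // subrr.
have [J [Ji IJ IJx]] := killing_complement Ii.
exists J; split=> //.
  apply: contraNneq xv0 => J0; have [y /IP yI] := IJx x0.
  by rewrite J0 memv0 subr_eq0 => /eqP->; rewrite yI.
have [R [Ri RJ R0 JR]] :=
  ideal_radical (trace_form_linear mod_act) (trace_form_invariant mod_act) Ji.
move=> x xJ x_0; have xR : x \in R by exact: JR.
suff R_0 : R = 0%VS by move: xR; rewrite R_0 memv0 => /eqP.
apply: (trace_form_solvable Ri R0) => y yR /IP yI; apply/eqP.
by rewrite -memv0 -IJ memv_cap yI (subvP RJ).
Qed.

(** The Killing form represents [l] by an element [z]; vanishing on brackets makes [z] central,
    hence zero. *)
Lemma semisimple_character (l : L -> K) : (forall a x y, l (a *: x + y) = a * l x + l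
  y) ->
  (forall x y, l [lie x, y] = 0) -> forall x, l x = 0.
Proof.
move=> l_lin l0.
have Fi : lie_ideal {:L} by apply/lie_idealP => x y _; rewrite memvf.
have [e [e' [_ _ eP _]]] := dual_bases kil_lin kilC (killing_nondegenerate Fi).
have l_0 : l 0 = 0 by have := l0 0 0; rewrite lie0l.
have lZ a x : l (a *: x) = a * l x by have := l_lin a x 0; rewrite l_0 !addr0.
have lD x y : l (x + y) = l x + l y by have := l_lin 1 x y; rewrite scale1r mul1r.
pose z := \sum_i l (e i) *: e' i.
have lz x : l x = killing z x.
  rewrite {1}(eP x (memvf x)) (big_morph l lD l_0) (form_suml kil_lin).
  by apply: eq_bigr => i _; rewrite lZ (formZl kil_lin) mulrC [killing x _]kilC.
have zc y : [lie z, y] = 0.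
  apply: (killing_nondegenerate Fi) => [|w _]; first exact: memvf.
  by rewrite kil_inv -lz l0.
by move=> x; rewrite lz (semisimple_center zc) (form0l kil_lin).
Qed.

(** As ad (D x) is the commutator of [D] with ad x, cyclicity of the trace turns [f x y] into the
    trace of [D] composed with ad [x, y]; [z] represents the functional taking [y] to the trace of
    [D] composed with ad y. *)
Lemma whitehead2_scalar (f : L -> L -> K) :
  (forall a x y z, f (a *: x + y) z = a * f x z + f y z) ->
  (forall a x y z, f z (a *: x + y) = a * f z x + f z y) ->
  (forall x y z, f [lie x, y] z = f x [lie y, z] - f y [lie x, z]) ->
  exists z, forall x y, f x y = killing z [lie x, y].
Proof.
move=> fl fr fc.
have Fi : lie_ideal {:L} by apply/lie_idealP => x y _; rewrite memvf.
have Fnd := killing_nondegenerate Fi.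
have [e [e' [_ _ eP e'P]]] := dual_bases kil_lin kilC Fnd.
have f0 x : f x 0 = 0 by have := fr 1 0 0 x; rewrite scaler0 addr0 mul1r => E;
  apply: (addrI (f x 0)); rewrite -E addr0.
have frD x y z : f x (y + z) = f x y + f x z by have := fr 1 y z x;
  rewrite scale1r mul1r.
have frZ a x y : f x (a *: y) = a * f x y by have := fr a y 0 x; rewrite f0 !addr0.
(* D is the derivation with f x y = killing (D x) y. *)
pose D x := \sum_i f x (e i) *: e' i.
have DP x y : killing (D x) y = f x y.
  rewrite {2}(eP y (memvf y)) (big_morph (f x) (frD x) (f0 x)) (form_suml kil_lin).
  by apply: eq_bigr => i _; rewrite frZ (formZl kil_lin) mulrC [killing y _]kilC.
have D_lin : linear D.
  move=> a x y; rewrite /D scaler_sumr -big_split; apply: eq_bigr => i _ /=.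
  by rewrite fl scalerDl scalerA.
have kil_eq x y : (forall z, killing x z = killing y z) -> x = y.
  move=> xy; apply/eqP; rewrite -subr_eq0; apply/eqP/Fnd => [|z _];
    first exact: memvf.
  by rewrite (formDl kil_lin) (formNl kil_lin) xy subrr.
have D_der x y : D [lie x, y] = [lie D x, y] + [lie x, D y].
  apply: kil_eq => z; rewrite DP fc (formDl kil_lin) kil_inv DP.
  by rewrite [[lie x, D y]]lieC (formNl kil_lin) kil_inv DP.
pose Dh := hom_of D_lin; pose ad := act_hom (adjoint_module L).
pose z := \sum_i ltrace (Dh \o ad (e i))%VF *: e' i.
have zP y : killing z y = ltrace (Dh \o ad y)%VF.
  have ad_lin := act_hom_linear (adjoint_module L).
  have tD u v : ltrace (Dh \o ad (u + v))%VF = ltrace (Dh \o ad u)%VF + ltrace (Dh \o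
    ad v)%VF.
    by rewrite -ltraceD -comp_lfunDr -(linear_rawD ad_lin).
  have t0 : ltrace (Dh \o ad 0)%VF = 0.
    by rewrite /ad (linear_raw0 ad_lin) comp_lfun0r ltrace0.
  rewrite {2}(eP y (memvf y)) (big_morph (fun u => ltrace (Dh \o ad u)%VF) tD t0).
  rewrite (form_suml kil_lin); apply: eq_bigr => i _.
  rewrite /ad (linear_rawZ ad_lin) -comp_lfunZr ltraceZ (formZl kil_lin) mulrC.
  by rewrite [killing y _]kilC.
exists z => x y; rewrite -DP zP /trace_form.
have -> : act_hom (adjoint_module L) (D x) = ((Dh \o ad x) - (ad x \o Dh))%VF.
  apply/lfunP => w; rewrite add_lfunE opp_lfunE !comp_lfunE !act_homE !hom_ofE.
  by rewrite D_der addrK.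
rewrite /ad act_hom_bracket comp_lfunDl comp_lfunDr comp_lfunNl comp_lfunNr !ltraceB.
congr (_ - _); first by rewrite comp_lfunA.
by rewrite -comp_lfunA ltrace_comp comp_lfunA.
Qed.

(** Induction on dim V: a proper submodule is handled by the exact sequence, a nontrivial
    irreducible module by the Casimir operator, a trivial module coordinatewise. *)
Theorem whitehead2 (V : vectType K) (act : L -> V -> V) :
  is_lie_module act -> cohomology2_zero act.
Proof.
have [n] := ubnP (\dim {:V}); elim: n V act => // n IHn V act dV mod_act f cf.
have [[U [Us U0 Uf]]|irr] := classic (exists U : {vspace V},
    [/\ act_stable act U, U != 0%VS & U != fullv]).
  have Zs : act_stable act 0%VS by move=> x v; rewrite !memv0 => /eqP->;
    rewrite act0r.
  have Fs : act_stable act fullv by move=> x v _; rewrite memvf.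
  have [A1 [act1 [p1 [s1 [m1 sP1 pI1 pact1 d1]]]]] :=
    subquotient_module mod_act Us Zs (sub0v U).
  have [A2 [act2 [p2 [s2 [m2 sP2 pI2 pact2 d2]]]]] :=
    subquotient_module mod_act Fs Us (subvf U).
  have dU0 : (0 < \dim U)%N by rewrite lt0n dimv_eq0.
  have dUV : (\dim U < \dim {:V})%N.
    by rewrite ltn_neqAle dimvS ?subvf // andbT; apply: contra Uf => dE;
      rewrite eqEdim subvf (eqP dE) leqnn.
  rewrite dimv0 in d1.
  have [|g2 lg2 f2E] := IHn _ _ _ m2 _ (cocycle2_map pact2 (fun x y => memvf _) cf);
    first by lia.
  have lsg2 : linear (fun x => s2 (g2 x)) by move=> a x y; rewrite lg2 linearP.
  (* A primitive modulo [U], lifted by [s2], is subtracted from [f], so that the remaining cocycle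
     takes values in [U]. *)
  pose f1 x y := f x y - (act x (s2 (g2 y)) - act y (s2 (g2 x)) - s2 (g2 [lie x, y])).
  have cf1 : cocycle2 act f1 by apply: cocycle2B => //; exact: cocycle2_diff.
  have p2s a : p2 (s2 a) = a by have [] := sP2 a.
  have f1U x y : f1 x y \in U.
    apply/pI2; first exact: memvf.
    by rewrite /f1 !linearB /= !pact2 ?memvf // !p2s f2E; vect_ring.
  have [|g1 lg1 f1E] := IHn _ _ _ m1 _ (cocycle2_map pact1 f1U cf1); first by lia.
  have lsg1 : linear (fun x => s1 (g1 x)) by move=> a x y; rewrite lg1 linearP.
  exists (fun x => s1 (g1 x) + s2 (g2 x)) => [a x y|x y].
    by rewrite lsg1 lsg2; vect_ring.
  have p1s a : p1 (s1 a) = a by have [] := sP1 a.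
  have s1U a : s1 a \in U by have [] := sP1 a.
  have : f1 x y - (act x (s1 (g1 y)) - act y (s1 (g1 x)) - s1 (g1 [lie x, y])) = 0.
    move: (f1 x y) (f1E x y) (f1U x y) => w wE wU.
    apply/eqP; rewrite -memv0; apply/pI1.
      by do !apply: rpredB => //; apply: Us.
    by rewrite !linearB /= wE !pact1 // !p1s; vect_ring.
  rewrite /f1 !actDr // => /eqP; rewrite subr_eq0 => /eqP E.
  by rewrite -[LHS](subrK (act x (s2 (g2 y)) - act y (s2 (g2 x)) - s2 (g2 [lie x,
    y]))) E; vect_ring.
have [[x0 [v0 xv0]]|triv] := classic (exists x v, act x v != 0).
  have [J [Ji J0 Jnd]] := trace_form_nondegenerate_ideal mod_act xv0.
  have [c [cact ctr cP]] := casimir Ji Jnd.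
  have [g lg gE] := cP f cf.
  (* Schur's argument: the kernel of [c] is a submodule, and it is not all of [V] because the trace
     dim J is nonzero in characteristic zero. *)
  have kerc : lker c == 0%VS.
    apply/negPn/negP => kc; apply: irr; exists (lker c); split=> //.
      by move=> x v; rewrite !memv_ker cact => /eqP->; rewrite act0r.
    apply: contra_neq J0 => kf; apply/eqP; rewrite -dimv_eq0.
    rewrite -(pchar0_natf_eq0 charK0) -ctr; suff -> : c = 0 by rewrite ltrace0.
    by apply/lfunP => v; rewrite zero_lfunE; apply/eqP; rewrite -memv_ker kf memvf.
  have cK := lker0_lfunK kerc; have cVK := lker0_lfunVK kerc.
  have cVact x v : (c^-1)%VF (act x v) = act x ((c^-1)%VF v).
    by apply: (can_inj cK); rewrite cact !cVK.
  exists (fun x => (c^-1)%VF (g x)) => [a x y|x y]; first by rewrite lg linearP.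
  by rewrite -[LHS]cK gE !linearB /= !cVact; vect_ring.
have act0 x v : act x v = 0.
  by apply/eqP/negPn/negP => xv; apply: triv; exists x, v.
have [fl fr fx fc] := cf.
pose phi i x y := coord (vbasis {:V}) i (f x y).
have phiP i : exists z, forall x y, phi i x y = killing z [lie x, y].
  apply: whitehead2_scalar => [a x y z|a x y z|x y z].
  - by rewrite /phi fl linearP.
  - by rewrite /phi fr linearP.
  - apply/eqP; rewrite -subr_eq0 /phi -!linearB; apply/eqP.
    rewrite -[RHS](linear0 (coord (vbasis {:V}) i)); congr (coord _ _ _).
    rewrite -[RHS]oppr0 -(fc x y z) !act0.
    rewrite (cocycle2C x [lie y, z] cf) (cocycle2C y [lie x, z] cf).
    by vect_ring.
have [z zP] := fin_all_exists phiP.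
exists (fun w => - \sum_i killing (z i) w *: (vbasis {:V})`_i) => [a x y|x y].
  rewrite scalerN -opprD scaler_sumr -big_split; congr (- _);
    apply: eq_bigr => i _ /=.
  by rewrite (formDr kil_lin kilC) (formZr kil_lin kilC) scalerDl scalerA.
rewrite !act0 subrr sub0r opprK {1}(coord_vbasis (memvf (f x y))).
by apply: eq_bigr => i _; rewrite -zP.
Qed.

End Whitehead.

(** * Consequences of the vanishing of H^2 *)

Lemma ce_cohomology2 (K : fieldType) (L : lieAlgType K) (V : vectType K)
    (act : L -> V -> V) : is_lie_module act ->
  ce_cohomology_zero act 2 -> cohomology2_zero act.
Proof.
move=> mod_act H2 f cf; have [fl fr fx fc] := cf.
pose F (x : {ffun 'I_2 -> L}) := f (x (inord 0)) (x (inord 1)).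
have o0 : inord 0 = ord0 :> 'I_2 by apply: val_inj; rewrite /= inordK.
have o1 : inord 1 = ord_max :> 'I_2 by apply: val_inj; rewrite /= inordK.
have ord2 (i : 'I_2) : i = ord0 \/ i = ord_max.
  by case: i => [[|[|//]]] ilt; [left|right]; apply: val_inj.
have [|g [gm _] gE] := H2 F.
  split; first split.
  - move=> x i; rewrite /F o0 o1; case: (ord2 i) => -> a u v; rewrite !ffunE /=.
      exact: fl.
    exact: fr.
  - move=> x i j; rewrite /F o0 o1.
    by case: (ord2 i) => ->; case: (ord2 j) => -> // _ ->.
  - move=> x; rewrite /ce_diff.
    pose X m := x (inord m).
    have xX (o : 'I_3) : x o = X o by rewrite /X inord_val.
    under [X in _ + X = _]eq_bigr do rewrite big_mkcond !big_ord_recl big_ord0.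
    rewrite !big_ord_recl !big_ord0 /= /F !ffunE /= !xX /= !inordK // /bump /=.
    rewrite !(addn0, add0n, add1n) -[RHS](fc (X 0%N) (X 1%N) (X 2%N)).
    by vect_ring.
pose cst w : {ffun 'I_1 -> L} := [ffun => w].
have upd u w : ffun_upd (cst u) ord0 w = cst w.
  by apply/ffunP => k; rewrite !ffunE (ord1 k) eqxx.
exists (fun u => g (cst u)) => [a u v|x y].
  by have := gm (cst u) ord0 a u v; rewrite !upd.
have := gE [ffun k => if k == ord0 then x else y].
rewrite /F o0 o1 !ffunE /= => ->; rewrite /ce_diff.
under [X in _ + X = _]eq_bigr do rewrite big_mkcond !big_ord_recl big_ord0.
rewrite !big_ord_recl !big_ord0 /= !ffunE /= !(addn0, add0n, add1n).
set h1 := omit _ _; set h2 := omit _ _; set h3 := contract _ _ _.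
have -> : h1 = cst y by apply/ffunP => k; rewrite (ord1 k) !ffunE.
have -> : h2 = cst x by apply/ffunP => k; rewrite (ord1 k) !ffunE.
have -> : h3 = cst [lie x, y] by apply/ffunP => k; rewrite (ord1 k) !ffunE.
by vect_ring.
Qed.

Section LiftCocycle.

Variables (K : fieldType) (L : lieAlgType K).
Hypothesis H2 : forall (V : vectType K) (act : L -> V -> V),
  is_lie_module act -> cohomology2_zero act.

(** The connecting map: the differential of the composite of [s] and [phi] takes values in the
    kernel of [pi], where it has a primitive; subtracting that primitive gives the lift. *)
Lemma lift_cocycle1 (V A : vectType K) (actV : L -> V -> V) (actA : L -> A -> A)
    (pi : 'Hom(V, A)) (s : 'Hom(A, V)) (phi : L -> A) :
  is_lie_module actV -> (forall x v, pi (actV x v) = actA x (pi v)) ->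
  (forall a, pi (s a) = a) -> cocycle1 actA phi ->
  exists2 psi, cocycle1 actV psi & forall x, pi (psi x) = phi x.
Proof.
move=> mV pact pis [lphi cphi].
have kerP v : (v \in lker pi) = (pi v == 0) by exact: memv_ker.
have Us : act_stable actV (lker pi).
  by move=> x v; rewrite !kerP pact => /eqP->;
    rewrite -(linear0 pi) -pact act0r ?linear0.
have Zs : act_stable actV 0%VS by move=> x v; rewrite !memv0 => /eqP->; rewrite act0r.
have [U [actU [p [j [mU jP pI pactU _]]]]] := subquotient_module mV Us Zs (sub0v _).
have lsphi : linear (fun x => s (phi x)) by move=> a x y; rewrite lphi linearP.
pose f x y := actV x (s (phi y)) - actV y (s (phi x)) - s (phi [lie x, y]).
have cf : cocycle2 actV f by exact: cocycle2_diff.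
have fU x y : f x y \in lker pi.
  by rewrite kerP !linearB /= !pact !pis cphi; apply/eqP; vect_ring.
have [g lg gE] := H2 mU (cocycle2_map pactU fU cf).
have jU a : j a \in lker pi by have [] := jP a.
have pj a : p (j a) = a by have [] := jP a.
have fE x y : f x y - (actV x (j (g y)) - actV y (j (g x)) - j (g [lie x, y])) = 0.
  move: (f x y) (gE x y) (fU x y) => w wE wU.
  apply/eqP; rewrite -memv0; apply/pI.
    by do !apply: rpredB => //; apply: Us.
  by rewrite !linearB /= wE !pactU // !pj; vect_ring.
exists (fun x => s (phi x) - j (g x)) => [|x]; last first.
  by rewrite linearB /= pis; have := jU (g x); rewrite kerP => /eqP->; rewrite subr0.
have ljg : linear (fun x => j (g x)) by move=> a x y; rewrite lg linearP.
split=> [a x y|x y]; first by rewrite lsphi ljg; vect_ring.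
apply/eqP; rewrite eq_sym -subr_eq0 -[X in _ == X](fE x y) /f !actBr //; apply/eqP.
by vect_ring.
Qed.

End LiftCocycle.

(** * Existence of the radical and semisimplicity of its quotient *)

Section Radical.

Variables (K : fieldType) (L : lieAlgType K).
Implicit Types (I J R : {vspace L}).

Lemma lie_solvableD I J : lie_ideal I -> lie_ideal J ->
  lie_solvable I -> lie_solvable J -> lie_solvable (I + J)%VS.
Proof.
move=> Ii Ji [m Im] [n Jn].
have Dn k : (lie_derived k (I + J) <= I + lie_derived k J)%VS.
  elim: k => [|k IHk] /=; first exact: subvv.
  apply: subv_trans (lie_bracketvS IHk IHk) _; apply: lie_bracketv_sub.
  move=> _ _ /memv_addP[a aI [b bJ ->]] /memv_addP[c cI [d dJ ->]].
  move/lie_idealP: Ii => Ii; rewrite lieDl !lieDr [[lie a, d]]lieC addrA.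
  apply: memv_add; last exact: mem_lie_bracketv.
  by rewrite !rpredD ?rpredN ?Ii.
exists (m + n)%N; apply/eqP; rewrite -subv0 lie_derivedD -Im.
by apply: lie_derivedS; apply: subv_trans (Dn n) _; rewrite Jn addv0 subvv.
Qed.

Lemma lie_radical_exists : exists R : {vspace L}, is_lie_radical R.
Proof.
have [|R [Ri Rs] Rmax] := @max_vspace _ _ (fun I =>
  lie_ideal I /\ lie_solvable I) 0%VS.
  split; last by exists 0%N.
  by apply/lie_idealP => x y; rewrite !memv0 => /eqP->; rewrite lie0r.
exists R; split=> // I Ii Is.
have dRI : (\dim (R + I) <= \dim R)%N.
  apply: Rmax; split; last exact: lie_solvableD.
  move/lie_idealP: Ri => Ri; move/lie_idealP: Ii => Ii;
    apply/lie_idealP => x _ /memv_addP[a aR [b bI ->]].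
  by rewrite lieDr memv_add ?Ri ?Ii.
suff /eqP -> : R == (R + I)%VS by exact: addvSr.
by rewrite eqEdim addvSl.
Qed.

Lemma lie_solvable_perfect I : lie_solvable I -> lie_bracketv I I = I -> I = 0%VS.
Proof.
move=> [n nI] II; rewrite -nI; elim: n {nI} => //= n <-.
by rewrite II.
Qed.

Lemma quotient_radical (S : lieAlgType K) R (p : 'Hom(L, S)) :
  is_lie_radical R -> (forall s, exists x, p x = s) -> (forall x, p x = 0 <-> x \in
    R) ->
  (forall x y, p [lie x, y] = [lie p x, p y]) -> lie_semisimple S.
Proof.
move=> [Ri Rs Rmax] psurj pR pB; split.
- by apply/lie_idealP => x y; rewrite !memv0 => /eqP->; rewrite lie0r.
- by exists 0%N.
move=> I /lie_idealP Ii [n In].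
have preD k : (lie_derived k (p @^-1: I) <= p @^-1: lie_derived k I)%VS.
  elim: k => [|k IHk] /=; first exact: subvv.
  apply: lie_bracketv_sub => x y /(subvP IHk) + /(subvP IHk).
  by rewrite -!memv_preim pB; exact: mem_lie_bracketv.
have /subvP preI : (p @^-1: I <= R)%VS.
  apply: Rmax; first by apply/lie_idealP => x y; rewrite -!memv_preim pB; exact: Ii.
  have [m Rm] := Rs; exists (m + n)%N; apply/eqP; rewrite -subv0 lie_derivedD -Rm.
  apply: lie_derivedS; apply: subv_trans (preD n) _; rewrite In.
  by apply/subvP => x; rewrite -memv_preim memv0 => /eqP/pR.
apply/subvP => s sI; have [x xs] := psurj s.
by rewrite memv0 -xs; apply/eqP/pR/preI; rewrite -memv_preim xs.
Qed.

End Radical.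

(** * Extending the projection of the radical to a cocycle *)

Section LeviCocycle.

Variables (K : fieldType) (L S : lieAlgType K) (R : {vspace L}).
Variables (p : 'Hom(L, S)) (q : 'Hom(S, L)).
Hypothesis pq : forall s, p (q s) = s.
Hypothesis pR : forall x, p x = 0 <-> x \in R.
Hypothesis pB : forall x y, p [lie x, y] = [lie p x, p y].
Variables (A : vectType K) (act : L -> A -> A) (mA : is_lie_module act).
Hypothesis actR : forall r a, r \in R -> act r a = 0.

Let qB s t : [lie q s, q t] - q [lie s, t] \in R.
Proof. by apply/pR; rewrite linearB /= pB !pq subrr. Qed.

Let act_q s t a : act (q [lie s, t]) a = act [lie q s, q t] a.
Proof.
by apply/eqP; rewrite eq_sym -subr_eq0 -actBl //; apply/eqP/actR/qB.
Qed.

Let act_qp x a : act (q (p x)) a = act x a.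
Proof.
apply/eqP; rewrite -subr_eq0 -actBl //; apply/eqP/actR/pR.
by rewrite linearB /= pq subrr.
Qed.

Lemma quotient_module : is_lie_module (fun s => act (q s)).
Proof.
split=> [v a x y|x|x y v].
- by rewrite linearP actDl // actZl.
- exact: lie_act_linearr.
- by rewrite act_q (lie_act_bracket mA).
Qed.

(** The failure of the linear section [q] to respect brackets lies in [R]; pushed to [A] by [pi] it
    is a 2-cocycle on [S], and its primitive [g] corrects the map sending [x] to
    [pi (x - q (p x))]. *)
Lemma extend_cocycle1 (pi : 'Hom(L, A)) :
  cohomology2_zero (fun s => act (q s)) ->
  (forall x r, r \in R -> pi [lie x, r] = act x (pi r)) ->
  exists2 phi, cocycle1 act phi & forall r, r \in R -> phi r = pi r.
Proof.
move=> H2S piR.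
pose f s t := pi ([lie q s, q t] - q [lie s, t]).
have cf : cocycle2 (fun s => act (q s)) f.
  split=> [t a s s'|s a t t'|s|x y z].
  - rewrite /f (linearP q) !lieDl !lieZl !linearB !linearD !linearZ /=; vect_ring.
  - rewrite /f (linearP q) !lieDr !lieZr !linearB !linearD !linearZ /=; vect_ring.
  - by rewrite /f !lie_bracketxx linear0 subr0 linear0.
  - rewrite /f -!piR //; do !rewrite -linearB -?linearD.
    rewrite -[RHS](linear0 pi); congr (pi _).
    rewrite !lieBr [[lie q [lie x, y], q z]]lieC [[lie q [lie x, z], q y]]lieC.
    rewrite [[lie q [lie y, z], q x]]lieC [[lie [lie x, z], y]]lieC [[lie [lie y, z],
      x]]lieC.
    rewrite [[lie [lie x, y], z]]lie_jacobil linearB !linearN /=.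
    rewrite [[lie q z, [lie q x, q y]]]lieC lie_jacobil.
    by rewrite [q (_ - _)]linearB /=; vect_ring.
have [g lg gE] := H2S f cf.
have gE' s t : g [lie s, t] = act (q s) (g t) - act (q t) (g s) - f s t.
  by rewrite gE; vect_ring.
have xR x : x - q (p x) \in R by apply/pR; rewrite linearB /= pq subrr.
exists (fun x => pi (x - q (p x)) + g (p x)) => [|r rR]; last first.
  by move/pR: (rR) => ->; rewrite linear0 subr0 (linear_raw0 lg) addr0.
split=> [a x y|x y].
  rewrite (linearP p) lg (linearP q) /=.
  have -> : a *: x + y - (a *: q (p x) + q (p y)) =
      a *: (x - q (p x)) + (y - q (p y)) by vect_ring.
  by rewrite (linearP pi) scalerDr addrACA.
rewrite pB gE' !act_qp !actDr // -!piR //.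
have piRR : pi [lie x - q (p x), y - q (p y)] = 0 by rewrite piR // actR.
apply/eqP; rewrite -subr_eq0 -[X in _ == X]oppr0 -piRR !lieBl !lieBr.
have piB u v : pi (u - v) = pi u - pi v by rewrite linearB.
have piN u : pi (- u) = - pi u by rewrite linearN.
rewrite /f [[lie q (p x), y]]lieC [[lie y, x]]lieC !piB !piN; apply/eqP.
by vect_ring.
Qed.

End LeviCocycle.

(** * The abelianization of the radical has dimension at most one *)

Section HomModule.

Variables (K : fieldType) (L : lieAlgType K) (X V : vectType K).
Variables (actX : L -> X -> X) (mX : is_lie_module actX).
Variables (actV : L -> V -> V) (mV : is_lie_module actV).

Definition hom_act x (F : 'Hom(X, V)) : 'Hom(X, V) :=
  ((act_hom mV x \o F) - (F \o act_hom mX x))%VF.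

Lemma hom_actE x F xi : hom_act x F xi = actV x (F xi) - F (actX x xi).
Proof. by rewrite add_lfunE opp_lfunE !comp_lfunE !act_homE. Qed.

Lemma hom_module : is_lie_module hom_act.
Proof.
split=> [F a x y|x a F G|x y F]; apply/lfunP => xi.
- rewrite [LHS]hom_actE [RHS]add_lfunE scale_lfunE !hom_actE !actDl // !actZl // homP.
  by vect_ring.
- rewrite [LHS]hom_actE [RHS]add_lfunE !scale_lfunE !hom_actE !add_lfunE !scale_lfunE
  actDr // actZr //.
  by vect_ring.
- rewrite [LHS]hom_actE [RHS]add_lfunE opp_lfunE !hom_actE !actBr //.
  rewrite !(lie_act_bracket mV) !(lie_act_bracket mX) linearB /=.
  by vect_ring.
Qed.

End HomModule.

(** The subspaces of vectors whose iterates from the j-th on are killed by [tau] increase strictly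
    for [j] up to [k.+1]: [iter (k - j) D z] lies in the next one but not in the j-th. *)
Lemma iterate_bound (K : fieldType) (L W : vectType K) (D : L -> L) (tau : L -> W) z
  k :
  linear D -> linear tau -> tau (iter k D z) != 0 ->
  (forall j, (k < j)%N -> tau (iter j D z) = 0) -> (k < \dim {:L})%N.
Proof.
move=> lD ltau zk zj.
have liter i : linear (iter i D).
  by elim: i => [|i IHi] a u v //=; rewrite IHi lD.
have mk j : exists M : {vspace L}, forall v, v \in M <->
    (forall i, tau (iter (i + j) D v) = 0).
  apply: vspace_of_pred => [i|a u v u0 v0 i].
    by rewrite (linear_raw0 (liter _)) (linear_raw0 ltau).
  by rewrite liter ltau u0 v0 scaler0 addr0.
suff H j : (j <= k.+1)%N -> exists2 M : {vspace L}, (j <= \dim M)%N &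
    forall v, v \in M <-> (forall i, tau (iter (i + j) D v) = 0).
  by have [M dM _] := H k.+1 (leqnn _); apply: leq_trans dM (dimvS (subvf _)).
elim: j => [_|j IHj jk]; first by have [M MP] := mk 0; exists M.
have [M dM MP] := IHj (ltnW jk); have [M' M'P] := mk j.+1; exists M' => //.
apply: leq_ltn_trans dM _.
have MM' : (M <= M')%VS.
  by apply/subvP => v /MP v0; apply/M'P => i; rewrite addnS -addSn.
have /ltn_leqif -> := dimv_leqif_sup MM'.
apply/negP => /subvP/(_ (iter (k - j) D z)).
have /[swap]/[apply] : iter (k - j) D z \in M'.
  by apply/M'P => i; rewrite -iterD zj //; lia.
move/MP/(_ 0%N)/eqP; rewrite add0n -iterD subnKC; last by lia.
by rewrite (negPf zk).
Qed.

Section Growth.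

Variables (K : fieldType) (L : lieAlgType K).
Hypothesis charK0 : [pchar K] =i pred0.
Hypothesis H2 : forall (V : vectType K) (act : L -> V -> V),
  is_lie_module act -> cohomology2_zero act.
Variables (A : vectType K) (actA : L -> A -> A) (mA : is_lie_module actA).
Variables (phi : L -> A) (cphi : cocycle1 actA phi).
Variables (R1 : {vspace L}) (ra rb : L).
Hypothesis raA : forall a, actA ra a = 0.
Hypothesis rbA : forall a, actA rb a = 0.
Hypothesis R1A : forall y a, y \in R1 -> actA y a = 0.
Hypothesis R1phi : forall y, y \in R1 -> phi y = 0.
Hypothesis raR1 : forall y, y \in R1 -> [lie ra, y] \in R1.
Hypothesis rabR1 : [lie ra, rb] \in R1.
Variable l : 'Hom(A, K^o).
Hypothesis la : l (phi ra) = 1.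
Hypothesis lb : l (phi rb) = 0.

(* The module of affine functions on A, on which L acts through phi: it contains
   the constant function e, and r_a acts on the coordinate function xi as - e. *)
Lemma affine_module :
  exists (X : vectType K) (actX : L -> X -> X) (eps : 'Hom(X, K^o)) (e xi : X),
  [/\ is_lie_module actX, eps e = 1, forall x, actX x e = 0,
      actX ra xi = - e & actX rb xi = 0 /\ forall y w, y \in R1 -> actX y w = 0].
Proof.
have [lphi phiB] := cphi.
(* The extension of the trivial module [K] by [A] with class [phi]. Linear forms on it, restricted
   to second coordinate 1, are the affine functions on [A]; [eps] is evaluation at the origin and
   [xi] is [l]. *)
pose actW x (w : A * K^o) : A * K^o := (actA x w.1 + (w.2 : K) *: phi x, 0).
have mW : is_lie_module actW.
  split=> [w a x y|x a u v|x y w].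
  - congr pair; last by rewrite /= scaler0 addr0.
    by rewrite /= actDl // actZl // lphi; vect_ring.
  - congr pair; last by rewrite /= scaler0 addr0.
    have -> : (a *: u + v).2 = (a : K) * u.2 + v.2 :> K by [].
    by rewrite /= actDr // actZr //; vect_ring.
  - congr pair; last by rewrite /= subr0.
    by rewrite /= (lie_act_bracket mA) phiB !actDr // !actZr // !scale0r; vect_ring.
have mK : is_lie_module (fun (_ : L) (_ : K^o) => 0 : K^o).
  by split=> [v a x y|x a u v|x y v]; rewrite ?scaler0 ?addr0 ?subrr.
have le : linear (fun w : A * K^o => w.2) by [].
have lxi : linear (fun w : A * K^o => l w.1) by move=> a u v; rewrite linearP.
pose w0 : A * K^o := (0, 1).
have leps : linear (fun F : 'Hom((A * K^o)%type, K^o) => F w0).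
  by move=> a F G; rewrite add_lfunE scale_lfunE.
exists 'Hom((A * K^o)%type, K^o), (hom_act mW mK), (hom_of leps), (hom_of le),
  (hom_of lxi).
split; last split.
- exact: hom_module.
- by rewrite !hom_ofE.
- by move=> x; apply/lfunP => w; rewrite [LHS]hom_actE [RHS]lfunE !hom_ofE subrr.
- apply/lfunP => w; rewrite [LHS]hom_actE [RHS]opp_lfunE !hom_ofE /= raA !add0r.
  by rewrite linearZ /= la [_ *: _]mulr1.
- apply/lfunP => w; rewrite [LHS]hom_actE [RHS]lfunE !hom_ofE /= rbA !add0r.
  by rewrite linearZ /= lb scaler0 oppr0.
- move=> y F yR; apply/lfunP => w; rewrite [LHS]hom_actE [RHS]lfunE sub0r.
  have -> : actW y w = 0 by rewrite /actW R1A // R1phi // scaler0 addr0.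
  by rewrite linear0 oppr0.
Qed.

(* V is the k-fold iterate of Hom (X, -) on A; pi evaluates at (e, .., e) and T at
   (xi, .., xi). *)
Lemma growth_module k :
  exists (V : vectType K) (act : L -> V -> V) (pi : 'Hom(V, A)) (s : 'Hom(A, V))
    (T : 'Hom(V, A)) (c : K),
  [/\ is_lie_module act, forall x v, pi (act x v) = actA x (pi v),
      forall a, pi (s a) = a, forall y v, y \in R1 -> act y v = 0 &
      [/\ c != 0, forall v, T (iter k (act ra) v) = c *: pi v,
          forall j v, (k < j)%N -> T (iter j (act ra) v) = 0 &
          forall j v, (k <= j.+1)%N -> T (iter j (act ra) (act rb v)) = 0]].
Proof.
have [X [actX [eps [e [xi [mX eps1 Xe Xra [Xrb XR1]]]]]]] := affine_module.
elim: k => [|k [V [act [pi [s [T [c [mV pact pis VR1 [c0 Tk Tj Tb]]]]]]]]].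
  exists A, actA, \1%VF, \1%VF, \1%VF, 1; split=> //.
  - by move=> x v; rewrite !id_lfunE.
  - by move=> a; rewrite !id_lfunE.
  - split=> [|v|[//|j] v _|j v _]; rewrite ?oner_eq0 ?id_lfunE ?scale1r //=.
    by elim: j => [|j IHj] /=; rewrite ?rbA // IHj raA.
have lpi : linear (fun F : 'Hom(X, V) => pi (F e)).
  by move=> a F G; rewrite add_lfunE scale_lfunE linearP.
have lT : linear (fun F : 'Hom(X, V) => T (F xi)).
  by move=> a F G; rewrite add_lfunE scale_lfunE linearP.
have lsa a : linear (fun z : X => (eps z : K) *: s a).
  by move=> b z z'; rewrite homP scalerDl scalerA.
have ls : linear (fun a => hom_of (lsa a)).
  move=> b a a'; apply/lfunP => z.
  by rewrite add_lfunE scale_lfunE !hom_ofE homP; vect_ring.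
pose hact := hom_act mX mV.
have itere j F : iter j (hact ra) F e = iter j (act ra) (F e).
  by elim: j => //= j IHj; rewrite hom_actE Xe linear0 subr0 IHj.
(* Since [ra] sends [xi] to [- e] and kills [e], only two terms of the Leibniz expansion survive. At
   [j = 0] the truncated predecessor is harmless, its coefficient being zero. *)
have iterxi j F : iter j (hact ra) F xi =
    iter j (act ra) (F xi) + iter j.-1 (act ra) (F e) *+ j.
  elim: j => [|j IHj] /=; first by rewrite mulr0n addr0.
  have iterN : iter j (hact ra) F (- e) = - iter j (hact ra) F e by exact: linearN.
  rewrite hom_actE Xra iterN opprK itere IHj actDr // -addrA; congr (_ + _).
  rewrite mulrSr; congr (_ + _).
  have actMn u i : act ra (u *+ i) = act ra u *+ i.
    by elim: i => [|i IHi]; rewrite ?mulr0n ?act0r // !mulrS actDr // IHi.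
  by rewrite actMn; case: (j).
have TDMn u v j : T (u + v *+ j) = T u + T v *+ j by rewrite linearD linearMn.
(* The constant starts at 1 and gains the factor [k.+1] here, so it is a factorial, nonzero in
   characteristic zero. *)
exists 'Hom(X, V), hact, (hom_of lpi), (hom_of ls), (hom_of lT), ((k.+1)%:R * c).
split.
- exact: hom_module.
- by move=> x F; rewrite !(hom_ofE lpi) hom_actE Xe linear0 subr0 pact.
- by move=> a; rewrite (hom_ofE lpi) (hom_ofE ls) (hom_ofE (lsa _)) eps1 scale1r pis.
- by move=> y F yR; apply/lfunP => z;
  rewrite [LHS]hom_actE [RHS]zero_lfunE VR1 // XR1 // linear0 subrr.
split.
- by rewrite mulf_neq0 // pchar0_natf_eq0.
- move=> F; rewrite (hom_ofE lT) (hom_ofE lpi) iterxi TDMn /= Tk (Tj k.+1) //.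
  by rewrite add0r -scaler_nat scalerA.
- move=> j F kj; rewrite (hom_ofE lT) iterxi TDMn !Tj ?mul0rn ?addr0 //; lia.
- move=> j F kj; have F0 : F 0 = 0 by exact: linear0.
  rewrite (hom_ofE lT) iterxi TDMn !hom_actE Xrb Xe F0 !subr0.
  rewrite Tb; last by lia.
  by case: j kj => [|j] kj; rewrite ?mulr0n ?addr0 //= Tb ?mul0rn ?addr0.
Qed.

(** [R1] acts trivially on the growth module, so the lift [psi] turns ad [ra] on [R1] into the
    action of [ra]. Were [phi rb] nonzero, [iterate_bound] would force more dimensions than [L]
    has. *)
Lemma growth_contradiction : phi rb = 0.
Proof.
apply/eqP/negPn/negP => b0; pose k := \dim {:L}.
(* The extra unit pays for the [ra] already contained in [[lie ra, rb]]: [T] then detects exactly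
   the k-th iterate. *)
have [V [act [pi [s [T [c [mV pact pis VR1 [c0 Tk Tj Tb]]]]]]]] := growth_module k.+1.
have [psi [lpsi psiB] psiE] := lift_cocycle1 H2 mV pact pis cphi.
pose D y := [lie ra, y].
have Dj j : iter j D [lie ra, rb] \in R1 by elim: j => //= j; exact: raR1.
have psij j : psi (iter j D [lie ra, rb]) =
    iter j (act ra) (act ra (psi rb) - act rb (psi ra)).
  elim: j => [|j IHj] /=; first by rewrite psiB.
  by rewrite {1}/D psiB IHj (VR1 _ _ (Dj j)) subr0.
have liter j u v : iter j (act ra) (u - v) = iter j (act ra) u - iter j (act ra) v.
  by elim: j => //= j ->; rewrite actBr.
have ltau : linear (fun y => T (psi y)) by move=> a x y; rewrite lpsi linearP.
suff : (k < k)%N by rewrite ltnn.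
apply: (iterate_bound (D := D) (tau := fun y => T (psi y)) (z := [lie ra, rb])) => //.
- exact: lie_bracket_linearr.
- rewrite psij liter linearB /= -iterSr Tk Tb // subr0 psiE.
  by rewrite scaler_eq0 negb_or c0.
- by move=> j kj; rewrite psij liter linearB /= -iterSr Tj ?Tb ?subr0 //; lia.
Qed.

End Growth.

(** * Radicals with one-dimensional abelianization *)

Section RankOne.

Variables (K : fieldType) (L : lieAlgType K).
Hypothesis charK0 : [pchar K] =i pred0.
Hypothesis H2 : forall (V : vectType K) (act : L -> V -> V),
  is_lie_module act -> cohomology2_zero act.
Variables (R B : {vspace L}) (x0 : L) (phi : L -> K).
Hypothesis BE : lie_bracketv R R = B.
Hypothesis BR : (B <= R)%VS.
Hypothesis Bs : lie_solvable B.
Hypothesis Bi : lie_ideal B.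
Hypothesis LR : forall x r, r \in R -> [lie x, r] \in B.
Hypothesis x0R : x0 \in R.
Hypothesis phi_lin : forall a x y, phi (a *: x + y) = a * phi x + phi y.
Hypothesis phiB : forall x y, phi [lie x, y] = 0.
Hypothesis phi_x0 : phi x0 = 1.
Hypothesis phi_ker : forall r, r \in R -> phi r = 0 -> r \in B.

(* On B / [B, B], where x0 acts invertibly by X, the map psi = X^-1 o pi o ad x0 is
   a cocycle extending the projection pi.  If phi /\ psi is the coboundary of
   sigma, then sigma induces an operator with [X, sigma] = 1, which has no trace
   in characteristic zero. *)
Lemma rank_one_derived_eq0 : B = 0%VS.
Proof.
have Bi' : forall x y, y \in B -> [lie x, y] \in B by apply/lie_idealP.
pose B2 := lie_bracketv B B.
have B2B : (B2 <= B)%VS by apply: lie_bracketv_sub => x y _; exact: Bi'.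
have B2i : lie_ideal B2 by exact: (lie_derived_ideal 1 Bi).
have BR' : {subset B <= R} by apply/subvP.
have [V [act [pi [s [mV sP pi0 pact dV]]]]] := subquotient_module (adjoint_module L)
  (Bi' : act_stable _ B) ((lie_idealP _).1 B2i : act_stable _ B2) B2B.
have sB a : s a \in B by have [] := sP a.
have pis a : pi (s a) = a by have [] := sP a.
have actB y v : y \in B -> act y v = 0.
  by move=> yB; rewrite -[v]pis -pact //; apply/pi0;
    [exact: Bi' | exact: mem_lie_bracketv].
pose X := act_hom mV x0.
have phi0 : phi 0 = 0 by rewrite -(phiB 0 0) lie0l.
have phiZ a x : phi (a *: x) = a * phi x by have := phi_lin a x 0;
  rewrite phi0 !addr0.
have phiD x y : phi (x + y) = phi x + phi y by have := phi_lin 1 x y;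
  rewrite scale1r mul1r.
have phi_B b : b \in B -> phi b = 0.
  move=> bB.
  have lphi : linear (phi : L -> K^o) by move=> a x y; exact: phi_lin.
  suff /subvP/(_ b bB) : (B <= lker (hom_of lphi))%VS by rewrite memv_ker hom_ofE =>
    /eqP.
  by rewrite -BE; apply: lie_bracketv_sub => x y _ _; rewrite memv_ker hom_ofE phiB.
(* Since [R] is the sum of [B] and the line of [x0], brackets in [R] are brackets with [x0] modulo
   [B, B], and these brackets span [B]. *)
have Xsurj : limg X = fullv.
  apply/eqP; rewrite eqEsubv subvf /=; apply/subvP => v _.
  suff /subvP/(_ (s v) (sB v)) : (B <= pi @^-1: limg X)%VS by rewrite -memv_preim pis.
  rewrite -{1}BE; apply: lie_bracketv_sub => r r' rR r'R; rewrite -memv_preim.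
  have dec z : z \in R -> z - phi z *: x0 \in B.
    move=> zR; apply: phi_ker; first by rewrite rpredB ?rpredZ.
    by rewrite phiD -scaleNr phiZ phi_x0 mulr1 subrr.
  set b := r - phi r *: x0; set b' := r' - phi r' *: x0.
  have -> : [lie r, r'] = phi r *: [lie x0, b'] - phi r' *: [lie x0, b] + [lie b, b'].
    rewrite /b /b' !(lieBl, lieBr, lieZl, lieZr) lie_bracketxx [[lie r, x0]]lieC.
    by vect_ring.
  have bbB2 : [lie b, b'] \in B2 by apply: mem_lie_bracketv; exact: dec.
  have -> : pi (phi r *: [lie x0, b'] - phi r' *: [lie x0, b] + [lie b, b']) =
      X (phi r *: pi b' - phi r' *: pi b).
    have pib : pi [lie b, b'] = 0 by apply/pi0 => //; exact: (subvP B2B).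
    have piZB a c u u' w : pi (a *: u - c *: u' + w) = a *: pi u - c *: pi u' + pi w.
      by rewrite linearD linearB !linearZ.
    rewrite piZB pib addr0 !pact ?dec // /X act_homE actBr // !actZr //.
  exact: memv_img (memvf _).
have Xker : lker X == 0%VS.
  rewrite -dimv_eq0; have := limg_ker_dim X fullv; rewrite capfv Xsurj; lia.
have XK := lker0_lfunK Xker; have XVK := lker0_lfunVK Xker.
have x0B y : [lie x0, y] \in B by rewrite lieC memvN LR.
(* The commutator of the two operators is the action of [[lie x0, y]], an element of [B]. *)
have Xact y v : X (act y v) = act y (X v).
  rewrite /X !act_homE; apply/eqP; rewrite -subr_eq0 -(lie_act_bracket mV).
  by rewrite actB.
have XVact y v : (X^-1)%VF (act y v) = act y ((X^-1)%VF v).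
  by apply: (can_inj XK); rewrite Xact !XVK.
pose psi y := (X^-1)%VF (pi [lie x0, y]).
have lpsi : linear psi.
  by move=> a y z; rewrite /psi (linear_rawD (lie_bracket_linearr _)) lieZr !homP
    -?homP linearP linearP.
have psiB y z : psi [lie y, z] = act y (psi z) - act z (psi y).
  rewrite /psi -!XVact -!pact // -linearB -linearB; congr (_ (pi _)).
  by rewrite [[lie z, [lie x0, y]]]lieC opprK lie_jacobil; vect_ring.
pose f y z := phi y *: psi z - phi z *: psi y.
have cf : cocycle2 act f.
  split=> [z a x y|x a y z|x|x y z].
  - by rewrite /f phi_lin lpsi; vect_ring.
  - by rewrite /f phi_lin lpsi; vect_ring.
  - by rewrite /f subrr.
  - by rewrite /f !phiB !psiB !actBr // !actZr //; vect_ring.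
have [sg lsg sgE] := H2 mV cf.
(* On [B] both [phi] and the action vanish, so the coboundary equation kills [sg] on brackets and
   [sg] descends to B / [B, B]. *)
have sgB2 y : y \in B2 -> sg y = 0.
  move=> yB2; suff /subvP/(_ y yB2) : (B2 <= lker (hom_of lsg))%VS.
    by rewrite memv_ker hom_ofE => /eqP.
  apply: lie_bracketv_sub => b b' bB b'B; rewrite memv_ker hom_ofE.
  have := sgE b b'; rewrite /f !phi_B // !scale0r !actB // subrr sub0r => /eqP.
  by rewrite eq_sym oppr_eq0.
have lSg : linear (fun v => sg (s v)) by move=> a u v; rewrite homP lsg.
pose Sg := hom_of lSg.
have comm : ((X \o Sg) - (Sg \o X))%VF = \1%VF.
  apply/lfunP => v; rewrite add_lfunE opp_lfunE !comp_lfunE id_lfunE !hom_ofE.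
  have := sgE x0 (s v); rewrite /f phi_x0 phi_B // scale1r scale0r subr0.
  rewrite (actB (s v)) // subr0 {1}/psi pact // pis -/X -(act_homE mV) XK => vE.
  rewrite [RHS]vE act_homE; congr (_ - _); apply/eqP;
    rewrite -subr_eq0 -(linear_rawB lsg).
  apply/eqP/sgB2/pi0; first by rewrite rpredB ?Bi'.
  have piB u w : pi (u - w) = pi u - pi w by rewrite linearB.
  by rewrite piB pis pact // pis ?act_homE subrr.
have : (\dim {:V})%:R = 0 :> K by rewrite -ltrace1 -comm ltraceB ltrace_comp subrr.
move/eqP; rewrite pchar0_natf_eq0 // => /eqP dV0.
apply: lie_solvable_perfect Bs _; apply/eqP; rewrite eqEdim B2B /=.
by move: dV; rewrite dV0 add0n /B2 => ->.
Qed.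

End RankOne.

(** [K] with zero bracket is the second factor, and [x] is sent to [(p x, phi x)]; [r0] adjusts the
    second coordinate without changing the first. *)
Lemma central_radical_split (K : fieldType) (L S : lieAlgType K) (p : 'Hom(L, S))
    (q : 'Hom(S, L)) (phi : L -> K) r0 :
  (forall s, p (q s) = s) -> (forall x y, p [lie x, y] = [lie p x, p y]) ->
  (forall a x y, phi (a *: x + y) = a * phi x + phi y) ->
  (forall x y, phi [lie x, y] = 0) -> p r0 = 0 -> phi r0 = 1 ->
  (forall x, p x = 0 -> phi x = 0 -> x = 0) ->
  exists A : lieAlgType K, \dim {:A} = 1%N /\ lie_isomorphic L (S * A)%type.
Proof.
move=> pq pB phi_lin phiB pr0 phi_r0 inj.
have br_linl (y : K^o) : linear (fun x : K^o => 0 : K^o).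
  by move=> a u v; rewrite scaler0 addr0.
have brJ (x y z : K^o) : 0 + 0 + 0 = 0 :> K^o by rewrite !addr0.
pose A : lieAlgType K := HB.pack (K^o)
  (Vector_isLieAlgebra.Build K K^o br_linl br_linl (fun _ => erefl) brJ).
exists A; split; first by rewrite dimvf.
pose f (x : L) : (S * A)%type := (p x, phi x : A).
have lf : linear f by move=> a x y; rewrite /f phi_lin linearP.
pose F : {linear L -> (S * A)%type} := HB.pack f (GRing.isLinear.Build K L (S *
  A)%type *:%R f lf).
exists F; split; last first.
  by move=> x y; congr pair; [exact: pB | exact: phiB].
have lphi : linear (phi : L -> K^o) by move=> a x y; exact: phi_lin.
have injF : injective F.
  move=> x y [pxy phixy]; apply/eqP; rewrite -subr_eq0; apply/eqP/inj.
    by rewrite linearB /= pxy subrr.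
  by rewrite (linear_rawB lphi) phixy subrr.
pose g (u : (S * A)%type) : L := q u.1 + ((u.2 : K) - phi (q u.1)) *: r0.
have FK : cancel g F.
  move=> [s t]; congr pair; rewrite /g /=.
    by rewrite linearD linearZ /= pr0 scaler0 addr0 pq.
  rewrite (linear_rawD lphi) (linear_rawZ lphi) phi_r0.
  by rewrite [_ *: _]mulr1 addrC subrK.
by exists g => // x; apply: injF; rewrite FK.
Qed.

Theorem theorem0p2 (K : fieldType) (L : lieAlgType K)
    (charK0 : [pchar K] =i pred0)
    (H2 : forall (V : vectType K) (act : L -> V -> V),
        is_lie_module act -> ce_cohomology_zero act 2) :
  [\/ \dim {:L} = 1%N,
      lie_semisimple L |
      exists S A : lieAlgType K,
        [/\ lie_semisimple S, \dim {:A} = 1%N &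
            lie_isomorphic L (S * A)%type]].
Proof.
have {}H2 (V : vectType K) (act : L -> V -> V) : is_lie_module act ->
  cohomology2_zero act.
  by move=> mV; apply: ce_cohomology2 => //; exact: H2.
have [R Rrad] := lie_radical_exists L; have [Ri Rs Rmax] := Rrad.
have [R0|R0] := eqVneq R 0%VS; first by apply: Or32; rewrite R0 in Rrad.
have Ri' : forall x y, y \in R -> [lie x, y] \in R by apply/lie_idealP.
have [S [p [q [pq pR pB]]]] := quotient_lie Ri.
have Sss : lie_semisimple S.
  by apply: (quotient_radical Rrad _ pR pB) => s; exists (q s).
(* A one-dimensional [L] also ends here: it is its own radical and [S] is zero. *)
apply: Or33; exists S; suff [A [dA iso]] : exists A : lieAlgType K,
    \dim {:A} = 1%N /\ lie_isomorphic L (S * A)%type by exists A.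
pose B := lie_bracketv R R.
have Bi : lie_ideal B by exact: (lie_derived_ideal 1 Ri).
have Bi' : forall x y, y \in B -> [lie x, y] \in B by apply/lie_idealP.
have BR : (B <= R)%VS by apply: lie_bracketv_sub => x y _; exact: Ri'.
have Bs : lie_solvable B.
  have [[|n] Rn] := Rs; first by case/eqP: R0.
  by exists n; rewrite -Rn -addn1 lie_derivedD.
have BneR : B != R by apply: contraNneq R0 => BE; apply/eqP/lie_solvable_perfect.
have [A [actA [pi [s [mA sP pi0 pact dA]]]]] :=
  subquotient_module (adjoint_module L) (Ri' : act_stable _ R) (Bi' : act_stable _ B)
    BR.
have sR a : s a \in R by have [] := sP a.
have pis a : pi (s a) = a by have [] := sP a.
have RA r a : r \in R -> actA r a = 0.
  by move=> rR; rewrite -[a]pis -pact //; apply/pi0;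
    [exact: Ri' | exact: mem_lie_bracketv].
have mS := quotient_module pq pR pB mA RA.
have [phi cphi phiE] := extend_cocycle1 pq pR pB mA RA (whitehead2 charK0 Sss mS)
  pact.
have [lphi phiB] := cphi.
have dA0 : (0 < \dim {:A})%N.
  rewrite lt0n; apply: contra BneR => /eqP dA0.
  by rewrite eqEdim BR -dA dA0 leqnn.
have BR' : {subset B <= R} by apply/subvP.
have phi_B y : y \in B -> phi y = 0 by move=> yB; rewrite phiE ?BR' //; apply/pi0;
  rewrite ?BR'.
have dA1 : (\dim {:A} <= 1)%N.
  rewrite leqNgt; apply/negP => dA2; pose b := vbasis {:A}.
  pose i0 := Ordinal dA0; pose i1 := Ordinal dA2.
  have bfree := basis_free (vbasisP {:A}).
  have lcoord : linear (coord b i0 : A -> K^o) by move=> a u v; rewrite linearP.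
  pose l : 'Hom(A, K^o) := hom_of lcoord.
  have phis i : phi (s b`_i) = b`_i by rewrite phiE // pis.
  (* Lifts of two basis vectors play [ra] and [rb]; the coordinate [l] is 1 on the first and 0 on
     the second. *)
  have : phi (s b`_i1) = 0.
    have bR i a : actA (s b`_i) a = 0 by apply: RA.
    have BA y a : y \in B -> actA y a = 0 by move/BR'; exact: RA.
    have sB y : y \in B -> [lie s b`_i0, y] \in B by exact: Bi'.
    have ssB : [lie s b`_i0, s b`_i1] \in B by exact: mem_lie_bracketv.
    apply: (growth_contradiction charK0 H2 mA cphi (bR _) (bR _) BA phi_B sB ssB (l
      := l)).
      by rewrite phis hom_ofE coord_free.
    by rewrite phis hom_ofE coord_free.
  rewrite phis => b1; have : b`_i1 != 0.
    by apply: (basis_not0 (vbasisP {:A})); rewrite mem_nth ?size_tuple.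
  by rewrite b1 eqxx.
have {}dA1 : \dim {:A} = 1%N by lia.
pose i0 : 'I_(\dim {:A}) := Ordinal dA0; pose v0 := (vbasis {:A})`_i0.
have lcoord : linear (coord (vbasis {:A}) i0 : A -> K^o) by move=> a u v;
  rewrite linearP.
pose l : 'Hom(A, K^o) := hom_of lcoord.
have lv0 : l v0 = 1 by rewrite hom_ofE coord_free ?eqxx // (basis_free (vbasisP _)).
have v0_neq0 : v0 != 0 by apply: (basis_not0 (vbasisP {:A}));
  rewrite mem_nth ?size_tuple.
have v0P a : a = (l a : K) *: v0.
  have /vlineP[k ->] : a \in <[v0]>%VS.
    suff -> : <[v0]>%VS = fullv by rewrite memvf.
    by apply/eqP; rewrite eqEdim subvf dA1 dim_vline v0_neq0.
  by rewrite linearZ /= lv0; congr (_ *: _); exact/esym/mulr1.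
(* [L] acts on the line [A] by a character that vanishes on [R], hence by a character of the
   semisimple [S], which is zero. *)
pose lam x : K := l (actA x v0).
have lam_lin a x y : lam (a *: x + y) = a * lam x + lam y.
  by rewrite /lam actDl // actZl // linearP.
have lamB x y : lam [lie x, y] = 0.
  have lamE z : actA z v0 = lam z *: v0 by exact: v0P.
  by rewrite /lam (lie_act_bracket mA) !lamE !actZr // !lamE !scalerA mulrC subrr
    linear0.
have lamR r : r \in R -> lam r = 0 by move=> rR; rewrite /lam RA ?linear0.
have lamD x y : lam (x + y) = lam x + lam y.
  by have := lam_lin 1 x y; rewrite scale1r mul1r.
have lamq s1 : lam (q s1) = 0.
  apply: (semisimple_character charK0 Sss (l := fun s => lam (q s))) => [a x y|x y].
    by rewrite linearP lam_lin.
  rewrite -[q [lie x, y]](subrK [lie q x, q y]) lamD lamB addr0; apply/lamR/pR.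
  by rewrite linearB /= pB !pq subrr.
have act0 x a : actA x a = 0.
  rewrite (v0P a) actZr // (v0P (actA x v0)) -/(lam x).
  suff -> : lam x = 0 by rewrite scale0r scaler0.
  rewrite -[x](subrK (q (p x))) lamD lamq addr0; apply/lamR/pR.
  by rewrite linearB /= pq subrr.
pose phi0 x : K := l (phi x).
have phi0_lin a x y : phi0 (a *: x + y) = a * phi0 x + phi0 y.
  by rewrite /phi0 lphi linearP.
have phi0B x y : phi0 [lie x, y] = 0 by rewrite /phi0 phiB !act0 subrr linear0.
have phi0_r0 : phi0 (s v0) = 1 by rewrite /phi0 phiE // pis.
have phi0_ker r : r \in R -> phi0 r = 0 -> r \in B.
  move=> rR r0; apply/pi0 => //; rewrite -phiE // (v0P (phi r)) -/(phi0 r).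
  by rewrite r0 scale0r.
have LR x r : r \in R -> [lie x, r] \in B.
  by move=> rR; apply/pi0; [exact: Ri' | rewrite pact ?act0].
have B0 : B = 0%VS.
  exact: (rank_one_derived_eq0 charK0 H2 (erefl B) BR Bs Bi LR (sR v0) phi0_lin phi0B
    phi0_r0 phi0_ker).
apply: (central_radical_split (p := p) (q := q) (phi := phi0) (r0 := s v0)) =>
  // [|x /pR xR x0].
  exact/pR.
by apply/eqP; rewrite -memv0 -B0 phi0_ker.
Qed.
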